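(* Let $\mathcal A_{\mathbb E}$ be the elliptic arrangement defined by $A$ and $b$. The associated category $\mathcal K$ is the face category of a polyhedral CW complex (denoted $K(\mathcal A_{\mathbb E})$).
   Context: **Arrangements.** Fix $\omega\in\mathbb C\setminus\mathbb R$ and let $\mathbb E=\mathbb C/\langle 1,\omega\rangle$ be the quotient by the lattice $\mathbb Z+\mathbb Z\omega$. Identify $S^1$ with $\mathbb R/\mathbb Z$, written additively. Let $A\in\mathbb Z^{d\times n}$ be an integer matrix of rank $d$ with nonzero columns $a_1,\dots,a_n$ (write $a_{j,k}$ for the $k$-th entry of $a_j$), and let $b_1,\dots,b_n\in\mathbb R/\mathbb Z$. Put $$\mathbf H_j=\Big\{z\in\mathbb E^d \,\Big|\, \sum_k a_{j,k}z_k=b_j+\omega b_j\Big\}\subseteq\mathbb E^d,\qquad H_j=\Big\{x\in(S^1)^d\,\Big|\,\sum_k a_{j,k}x_k=b_j\Big\}\subseteq (S^1)^d .$$ The toric arrangement is $\mathcal A=\{H_1,\dots,H_n\}$ and the elliptic arrangement is $\mathcal A_{\mathbb E}=\{\mathbf H_1,\dots,\mathbf H_n\}$. **Face category $\mathcal F$ of the toric arrangement.** Let $\mathcal A^{\upharpoonright}$ be the locally finite, $\mathbb Z^d$-periodic arrangement of all affine hyperplanes in $\mathbb R^d$ that are connected components of preimages of the $H_j$ under $\mathbb R^d\to(\mathbb R/\mathbb Z)^d=(S^1)^d$. It subdivides $\mathbb R^d$ into relatively open faces whose closures are polytopes, and $\mathbb Z^d$ acts freely on the set of faces by translation. The category $\mathcal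 F=\mathcal F(\mathcal A)$ (the face category of the induced polyhedral CW structure $K_{\mathcal A}$ on $(S^1)^d$) has as objects the $\mathbb Z^d$-orbits of faces of $\mathcal A^{\upharpoonright}$ (equivalently, the open cells of $K_{\mathcal A}$, i.e. the images of faces in $(S^1)^d$); morphisms $F\to G$ are the $\mathbb Z^d$-orbits of pairs $(P,Q)$ of faces with $P$ in the orbit $F$, $Q$ in the orbit $G$, and $P\subseteq\overline Q$; composition is induced by transitivity of the relation $P\subseteq\overline{Q}$. For an object $F$ let $\operatorname{supp}(F)=\{H\in\mathcal A\mid F\subseteq H\}$. **The category $\mathcal K$.** Its objects are the pairs $(F,G)$ of objects of $\mathcal F$ with $\operatorname{supp}(F)\cap\operatorname{supp}(G)=\emptyset$; its morphisms $(F_1,G_1)\to(F_2,G_2)$ are the pairs $(\alpha,\beta)$ with $\alpha\in\operatorname{Mor}_{\mathcal F^{op}}(F_1,F_2)$, $\beta\in\operatorname{Mor}_{\mathcal F^{op}}(G_1,G_2)$, composed componentwise. **Polyhedral CW complexes and face categories.** Faces of a polytope $P$ are the nonempty subsets $\{x\in P\mid \ell(x)=c\}$ with $\ell$ a linear form and $\ell\ge c$ on $P$ (so $P$ is a face of itself). A polyhedral homeomorphism is a homeomorphism between polytopes mapping every face onto a face. A polyhedral CW complex is a Hausdorff space $K$ with continuous maps $\{\alpha:P_\alpha\to K\}_{\alpha\in I}$, each $P_\alpha$ a convex polytope, such that, with $F(\alpha)=\alpha(\operatorname{int}P_\alpha)$ ($\operatorname{int}$ = relative interior): (PC0) $\alpha|_{\operatorname{int}P_\alpha}$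 is a homeomorphism onto its image; (PC1) $K$ is the disjoint union of the $F(\alpha)$; (PC2) $B\subseteq K$ is closed iff $B\cap\alpha(P_\alpha)$ is closed for all $\alpha\in I$; (PC3) for every $\alpha$ and every face $F$ of $P_\alpha$ there are $\beta\in I$ and a polyhedral homeomorphism $\phi^F:P_\beta\to F$ with $\beta=\alpha\circ\phi^F$ (these are unique). The face category of $K$ has object set $I$ and as morphisms all $\phi^F:P_\beta\to F$ ($F$ a face of some $P_\alpha$), with source $\beta$ and target $\alpha$; composing $\phi^F:\alpha\to\beta$ with $\phi^G:\beta\to\gamma$ gives $\phi^{\phi^G(F)}:\alpha\to\gamma$. ''Is the face category of'' means ''is isomorphic to the face category of''. *)

(* Defs.v *)
From HB Require Import structures.
From mathcomp Require Import all_boot all_order all_algebra.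
From mathcomp Require Import all_classical all_reals all_analysis.
From mathcomp Require Import complex generic_quotient ring_quotient.
From mathcomp Require Import ring lra zify.

Set Implicit Arguments.
Unset Strict Implicit.
Unset Printing Implicit Defensive.

Import Order.TTheory GRing.Theory Num.Theory numFieldNormedType.Exports.

Local Open Scope classical_set_scope.
Local Open Scope ring_scope.
Local Open Scope quotient_scope.

(** * Categories *)

Record category := Category {
  obj : Type;
  hom : obj -> obj -> Type;
  idc : forall x, hom x x;
  (* diagrammatic order: [compc f g] is "f, then g" *)
  compc : forall x y z, hom x y -> hom y z -> hom x z;
  comp1c : forall x y (f : hom x y), compc (idc x) f = f;
  compc1 : forall x y (f : hom x y), compc f (idc y) = f;
  compcA : forall x y z t (f : hom x y) (g : hom y z) (h : hom z t),
    compc f (compc g h) = compc (compc f g) h }.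

Arguments idc {c} x.
Arguments compc {c x y z} f g.

Definition op_category (C : category) : category :=
  @Category (obj C) (fun x y => hom y x) (fun x => idc x)
    (fun x y z f g => compc g f)
    (fun x y f => compc1 f) (fun x y f => comp1c f)
    (fun x y z t f g h => esym (compcA h g f)).

Section ProductCategory.
Variables C D : category.

Definition prod_hom (x y : obj C * obj D) := (hom x.1 y.1 * hom x.2 y.2)%type.
Definition prod_id (x : obj C * obj D) : prod_hom x x := (idc x.1, idc x.2).
Definition prod_comp x y z (f : prod_hom x y) (g : prod_hom y z) :
  prod_hom x z := (compc f.1 g.1, compc f.2 g.2).

Definition prod_category : category.
Proof.
refine (@Category _ prod_hom prod_id prod_comp _ _ _).
- by move=> x y [f g]; rewrite /prod_comp /= !comp1c.
- by move=> x y [f g]; rewrite /prod_comp /= !compc1.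
- by move=> x y z t f g h; rewrite /prod_comp /= !compcA.
Defined.

End ProductCategory.

Definition full_subcategory (C : category) (P : obj C -> Prop) : category :=
  @Category {x : obj C | P x} (fun x y => hom (sval x) (sval y))
    (fun x => idc (sval x)) (fun x y z f g => compc f g)
    (fun x y f => comp1c f) (fun x y f => compc1 f)
    (fun x y z t f g h => compcA f g h).

Definition isomorphic_categories (C D : category) : Prop :=
  exists (F : obj C -> obj D)
         (Fm : forall x y : obj C, hom x y -> hom (F x) (F y)),
    [/\ bijective F, forall x y, bijective (@Fm x y),
        forall x, Fm x x (idc x) = idc (F x) &
        forall x y z (f : hom x y) (g : hom y z),
          Fm x z (compc f g) = compc (Fm x y f) (Fm y z g)].

(** * Polytopes *)

Section Polytopes.
Variable R : realType.

Section FixedDimension.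
Variable m : nat.
Local Notation V := 'rV[R]_m.

Definition convex_hull k (p : 'I_k -> V) : set V :=
  [set x | exists w : 'I_k -> R,
     [/\ forall i, 0 <= w i, \sum_i w i = 1 & x = \sum_i w i *: p i]].

(* nonempty, since there is at least one point *)
Definition is_polytope (P : set V) : Prop :=
  exists k (p : 'I_k.+1 -> V), P = convex_hull p.

Definition affine_hull (P : set V) : set V :=
  [set x | exists k (p : 'I_k -> V) (w : 'I_k -> R),
     [/\ forall i, P (p i), \sum_i w i = 1 & x = \sum_i w i *: p i]].

Definition relative_interior (P : set V) : set V :=
  [set x | P x /\ \forall y \near x, affine_hull P y -> P y].

Definition is_face (P F : set V) : Prop :=
  F !=set0 /\
  exists (l : {scalar V}) (c : R),
    (forall x, P x -> c <= l x) /\ F = [set x | P x /\ l x = c].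

Lemma is_face_sub P F : is_face P F -> F `<=` P.
Proof. by case=> _ [l [c [_ ->]]] x []. Qed.

Lemma is_face_refl P : is_polytope P -> is_face P P.
Proof.
move=> [k [p ->]]; split.
  exists (p ord0), (fun i => (i == ord0)%:R); split.
  - by move=> i; rewrite ler0n.
  - by rewrite (bigD1 ord0) //= big1 ?addr0 // => i /negbTE ->.
  - rewrite (bigD1 ord0) //= big1 ?addr0 ?scale1r // => i /negbTE ->.
    by rewrite scale0r.
exists \0, 0; split=> [x _|]; first exact: lexx.
by apply/seteqP; split=> x // [].
Qed.

Lemma is_face_mono P Q F : F `<=` Q -> Q `<=` P -> is_face P F -> is_face Q F.
Proof.
move=> FQ QP [F0 [l [c [lP FE]]]]; split=> //; exists l, c; split.
  by move=> x /QP /lP.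
apply/seteqP; split=> x.
  by move=> Fx; split; [exact: FQ|move: Fx; rewrite FE => -[]].
by case=> Qx lx; rewrite FE; split; [exact: QP|].
Qed.

Lemma is_face_trans P F G :
  is_polytope P -> is_face P F -> is_face F G -> is_face P G.
Proof.
move=> [k [p PE]] [F0 [l [c [lP FE]]]] [G0 [l' [c' [lF GE]]]].
split=> //.
have Pp i : P (p i).
  rewrite PE; exists (fun j => (j == i)%:R); split.
  - by move=> j; rewrite ler0n.
  - by rewrite (bigD1 i) //= eqxx big1 ?addr0 // => j /negbTE ->.
  - rewrite (bigD1 i) //= eqxx big1 ?addr0 ?scale1r // => j /negbTE ->.
    by rewrite scale0r.
pose N := 1 + \sum_i `|(c' - l' (p i)) / (l (p i) - c)|.
pose L : {scalar V} := (l' \+ N \*: l).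
have LE x : L x = l' x + N * l x by [].
pose C := c' + N * c.
have Lp i : C <= L (p i) /\ (L (p i) = C -> l (p i) = c /\ l' (p i) = c').
  rewrite LE /C; have := lP _ (Pp i); rewrite le_eqVlt => /orP[/eqP ce|cl].
    have lF' : c' <= l' (p i) by apply: lF; rewrite FE.
    by rewrite -ce lerD2r; split=> // /addIr.
  have d0 : 0 < l (p i) - c by rewrite subr_gt0.
  have : c' - l' (p i) < N * (l (p i) - c).
    rewrite -ltr_pdivrMr // (le_lt_trans (ler_norm _)) // /N.
    rewrite (bigD1 i) //= addrCA ltrDl ltr_wpDr ?ltr01 //.
    by apply: sumr_ge0 => j _; exact: normr_ge0.
  move=> H; have {}H : c' + N * c < l' (p i) + N * l (p i).
    rewrite -subr_gt0 (_ : _ - _ = N * (l (p i) - c) - (c' - l' (p i))).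
      by rewrite subr_gt0.
    by ring.
  by split=> [|E]; [exact: ltW|move: H; rewrite E ltxx].
have hull x : P x -> exists w : 'I_k.+1 -> R,
    [/\ forall i, 0 <= w i, \sum_i w i = 1 &
     forall h : {scalar V}, h x = \sum_i w i * h (p i)].
  rewrite PE => -[w [w0 w1 ->]]; exists w; split=> // h.
  by rewrite linear_sum; apply: eq_bigr => i _; rewrite linearZ.
have sumC (w : 'I_k.+1 -> R) e : \sum_i w i = 1 -> e = \sum_i w i * e.
  by move=> w1; rewrite -mulr_suml w1 mul1r.
exists L, C; split=> [x /hull[w [w0 w1 wE]]|].
  rewrite wE (sumC w C) //; apply: ler_sum => i _.
  by apply: ler_wpM2l; [exact: w0|exact: (Lp i).1].
apply/seteqP; split=> x.
  rewrite GE => -[Fx l'x]; move: Fx; rewrite FE => -[Px lx]; split=> //.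
  by rewrite LE lx l'x.
case=> /[dup] Px /hull[w [w0 w1 wE]] Lx.
have wi i : w i * (L (p i) - C) = 0.
  apply: (@psumr_eq0P R _ xpredT (fun i => w i * (L (p i) - C))) => //.
    by move=> j _; rewrite mulr_ge0 // subr_ge0; exact: (Lp j).1.
  under eq_bigr do rewrite mulrBr.
  by rewrite big_split /= sumrN -(sumC w C) // -(wE L) Lx subrr.
have wi' i : w i * l (p i) = w i * c /\ w i * l' (p i) = w i * c'.
  have /eqP := wi i; rewrite mulf_eq0 => /orP[/eqP ->|]; first by rewrite !mul0r.
  by rewrite subr_eq0 => /eqP /(Lp i).2 [-> ->].
have lx : l x = c.
  by rewrite wE (sumC w c) //; apply: eq_bigr => i _; exact: (wi' i).1.
have l'x : l' x = c'.
  by rewrite wE (sumC w c') //; apply: eq_bigr => i _; exact: (wi' i).2.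
by rewrite GE; split=> //; rewrite FE.
Qed.

End FixedDimension.

Record polytope := Polytope {
  polytope_dim : nat;
  polytope_set :> set 'rV[R]_polytope_dim;
  polytopeP : is_polytope polytope_set }.

End Polytopes.

(** * Homeomorphisms *)

(* f restricts to a homeomorphism from A onto the subspace f(A) *)
Definition homeo_onto_image (X Y : topologicalType) (A : set X) (f : X -> Y) :=
  {within A, continuous f} /\
  exists2 g : Y -> X, {in A, cancel f g} & {within f @` A, continuous g}.

Section PolyhedralHomeomorphisms.
Variable R : realType.

(* image of a subset F of the ambient space of P, for f : P -> Q *)
Definition subset_image (P Q : polytope R) (f : P -> Q)
    (F : set 'rV[R]_(polytope_dim P)) : set 'rV[R]_(polytope_dim Q) :=
  [set \val (f x) | x in [set x : P | F (\val x)]].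

(* f, corestricted to F, is a polyhedral homeomorphism P -> F; the polytope F
   is a subset (in practice a face) of Q *)
Definition polyhedral_homeo (P Q : polytope R)
    (F : set 'rV[R]_(polytope_dim Q)) (f : P -> Q) : Prop :=
  [/\ homeo_onto_image [set: P] f,
      subset_image f P = F &
      forall E, is_face P E -> is_face F (subset_image f E)].

Lemma subset_image_id (P : polytope R) (F : set 'rV[R]_(polytope_dim P)) :
  F `<=` P -> subset_image (fun x : P => x) F = F.
Proof.
move=> FP; apply/seteqP; split=> x; first by case=> y Fy <-.
by move=> Fx; exists (exist _ x (mem_set (FP _ Fx))).
Qed.

Lemma subset_image_comp (P Q S : polytope R) (f : P -> Q) (g : Q -> S)
    (F : set 'rV[R]_(polytope_dim P)) :
  subset_image (g \o f) F = subset_image g (subset_image f F).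
Proof.
apply/seteqP; split=> x.
  by case=> y Fy <-; exists (f y) => //; exists y.
case=> y [z Fz] /val_inj <- <-; exists z => //.
Qed.

Lemma subset_imageS (P Q : polytope R) (f : P -> Q)
    (E F : set 'rV[R]_(polytope_dim P)) :
  E `<=` F -> subset_image f E `<=` subset_image f F.
Proof. by move=> EF x [y Ey <-]; exists y => //; exact: EF. Qed.

Lemma homeo_id (X : topologicalType) :
  homeo_onto_image [set: X] (fun x : X => x).
Proof.
split; first by apply: continuous_subspaceT => x.
by exists id => //; apply: continuous_subspaceT => x.
Qed.

Lemma homeo_comp (X Y Z : topologicalType) (f : X -> Y) (g : Y -> Z) :
  homeo_onto_image [set: X] f -> homeo_onto_image [set: Y] g ->
  homeo_onto_image [set: X] (g \o f).
Proof.
move=> [cf [f' fK cf']] [cg [g' gK cg']]; split.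
  apply: continuous_subspaceT => x; apply: continuous_comp.
    by move: (x); apply/continuous_subspace_setT.
  by move: (f x); apply/continuous_subspace_setT.
exists (f' \o g') => [x _ /=|]; first by rewrite gK ?fK ?inE.
apply/subspace_continuousP => _ [x _ <-] U; rewrite /from_subspace /= gK ?inE // => nU.
have fx : [set f x | x in [set: X]] (f x) by exists x.
have gfx : [set g y | y in [set: Y]] (g (f x)) by exists (f x).
have W := (subspace_continuousP _ _).1 cf' _ fx U nU.
have := (subspace_continuousP _ _).1 cg' _ gfx; rewrite /from_subspace /= gK ?inE // => /(_ _ W).
have imp : [set z | range g z -> [set y | range f y -> U (f' y)] (g' z)]
    `<=` [set z | range (g \o f) z -> U (f' (g' z))]; last exact: (filterS imp).
move=> z /= Hz [t _ tz]; move: (Hz (ex_intro2 _ _ (f t) I tz)).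
by apply; exists t => //; rewrite -tz /= gK ?inE.
Qed.

End PolyhedralHomeomorphisms.

(** * Polyhedral CW complexes and their face categories *)

Definition polytope_interior (R : realType) (P : polytope R) : set P :=
  [set x : P | relative_interior P (\val x)].
Arguments polytope_interior {R} P.

Definition open_cell (R : realType) (X : Type) (P : polytope R) (f : P -> X) :
  set X := f @` polytope_interior P.

Record polyhedral_complex (R : realType) := PolyhedralComplex {
  pc_space : topologicalType;
  pc_index : Type;
  pc_polytope : pc_index -> polytope R;
  pc_map : forall a, pc_polytope a -> pc_space;
  pc_hausdorff : hausdorff_space pc_space;
  pc_continuous : forall a, continuous (@pc_map a);
  PC0 : forall a, homeo_onto_image (polytope_interior (pc_polytope a)) (@pc_map a);
  PC1 : \bigcup_a open_cell (@pc_map a) = [set: pc_space] /\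
        trivIset [set: pc_index] (fun a => open_cell (@pc_map a));
  PC2 : forall B : set pc_space,
    closed B <-> forall a, closed (B `&` range (@pc_map a));
  PC3 : forall a (F : set 'rV[R]_(polytope_dim (pc_polytope a))),
    is_face (pc_polytope a) F ->
    exists b (phi : pc_polytope b -> pc_polytope a),
      polyhedral_homeo F phi /\ forall x, pc_map x = pc_map (phi x) }.

Section FaceCategory.
Variables (R : realType) (K : polyhedral_complex R).
Local Notation P := (pc_polytope (p := K)).

(* phi : P_b -> P_a is one of the maps phi^F of PC3, seen as a map into P_a *)
Definition is_face_map (b a : pc_index K) (phi : P b -> P a) : Prop :=
  (exists2 F, is_face (P a) F & polyhedral_homeo F phi) /\
  forall x, pc_map x = pc_map (phi x).

Definition face_hom (b a : pc_index K) :=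
  {phi : P b -> P a | is_face_map phi}.

Lemma face_id_subproof a : is_face_map (fun x : P a => x).
Proof.
split=> //; exists (P a); first exact/is_face_refl/polytopeP.
split; first exact: homeo_id.
  by apply: subset_image_id.
by move=> E EP; rewrite subset_image_id //; exact: is_face_sub.
Qed.

Definition face_id a : face_hom a a := exist _ _ (face_id_subproof a).

Lemma face_comp_subproof a b c (f : face_hom a b) (g : face_hom b c) :
  is_face_map (sval g \o sval f).
Proof.
case: f g => [f [[F bF [hf fE fF]] fm]] [g [[G cG [hg gE gF]] gm]] /=.
have gFG : is_face G (subset_image g F) by exact: gF.
split; last by move=> x; rewrite fm gm.
exists (subset_image g F); first exact: is_face_trans (polytopeP _) cG gFG.
split; first exact: homeo_comp.
  by rewrite subset_image_comp fE.
move=> E aE; rewrite subset_image_comp; have FE := fF _ aE.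
apply: (@is_face_mono _ _ G); last exact/gF/(is_face_trans (polytopeP _) bF).
  by apply: subset_imageS; exact: is_face_sub FE.
exact: is_face_sub gFG.
Qed.

(* The composite of phi^F and phi^G is the map phi^G o phi^F, whose image is
   the face phi^G(F); hence it is the unique face map with that image. *)
Definition face_comp a b c (f : face_hom a b) (g : face_hom b c) :
  face_hom a c := exist _ _ (face_comp_subproof f g).

Definition face_category : category.
Proof.
refine (@Category (pc_index K) face_hom face_id face_comp _ _ _).
- by move=> a b [f fP]; apply: eq_exist.
- by move=> a b [f fP]; apply: eq_exist.
- by move=> a b c d f g h; apply: eq_exist.
Defined.

End FaceCategory.

(** * Elliptic and toric arrangements *)

Section Circle.
Variable R : realType.

Definition integers : {pred R} := fun x => x \is a Num.int.

Lemma integers_closed : zmod_closed integers.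
Proof.
by split=> [|x y]; rewrite /integers !unfold_in => *; [exact: rpred0|exact: rpredB].
Qed.

HB.instance Definition _ := GRing.isZmodClosed.Build R integers integers_closed.

(* the group R/Z *)
Definition circle := Quotient.quot integers.

HB.instance Definition _ := GRing.Zmodule.on circle.

Definition circle_pi (x : R) : circle := \pi_circle x.

End Circle.

Section EllipticCurve.
Variables (R : realType) (omega : R[i]).

Definition period_lattice : {pred R[i]} :=
  fun z => `[< exists p q : int, z = p%:~R + q%:~R * omega >].

Lemma period_lattice_closed : zmod_closed period_lattice.
Proof.
split=> [|x y]; rewrite /period_lattice !unfold_in.
  by apply/asboolP; exists 0, 0; rewrite mul0r addr0.
move=> /asboolP[p [q ->]] /asboolP[p' [q' ->]]; apply/asboolP.
by exists (p - p'), (q - q'); rewrite !intrB; ring.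
Qed.

HB.instance Definition _ :=
  GRing.isZmodClosed.Build R[i] period_lattice period_lattice_closed.

(* E = C / <1, omega> *)
Definition elliptic_curve := Quotient.quot period_lattice.

HB.instance Definition _ := GRing.Zmodule.on elliptic_curve.

(* s + omega t for s, t in R/Z; independent of the representatives, since 1 and
   omega are periods *)
Definition elliptic_point (s t : circle R) : elliptic_curve :=
  \pi_elliptic_curve ((repr s)%:C + omega * (repr t)%:C)%C.

End EllipticCurve.

(* sum_k a_{j,k} x_k, with a_j the j-th column of A, in an abelian group M *)
Definition column_form (M : zmodType) d n (A : 'M[int]_(d, n)) (j : 'I_n)
  (x : 'rV[M]_d) : M := \sum_k x 0 k *~ A k j.

Record arrangement_data (R : realType) (d n : nat) := ArrangementData {
  ar_omega : R[i];
  ar_omega_nonreal : complex.Im ar_omega != 0;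
  ar_mx : 'M[int]_(d, n);
  ar_offset : 'I_n -> circle R;
  ar_mx_rank : \rank (map_mx (intr : int -> rat) ar_mx) = d;
  ar_col_neq0 : forall j, col j ar_mx != 0 }.

Section Arrangements.
Variables (R : realType) (d n : nat) (X : arrangement_data R d n).
Local Notation V := 'rV[R]_d.
Local Notation A := (ar_mx X).
Local Notation b := (ar_offset X).

Definition elliptic_hyperplane (j : 'I_n) :
    set 'rV[elliptic_curve (ar_omega X)]_d :=
  [set z | column_form A j z = elliptic_point (ar_omega X) (b j) (b j)].

Definition elliptic_arrangement := range elliptic_hyperplane.

Definition toric_hyperplane (j : 'I_n) : set 'rV[circle R]_d :=
  [set x | column_form A j x = b j].

Definition toric_arrangement := range toric_hyperplane.

Definition torus_pi (x : V) : 'rV[circle R]_d := map_mx (@circle_pi R) x.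

Definition lifted_arrangement : set (set V) :=
  [set L | exists2 H, toric_arrangement H &
     exists2 x, (torus_pi @^-1` H) x &
       L = connected_component (torus_pi @^-1` H) x].

(* x and y lie on the same side of, or both on, each hyperplane {l = c} of the
   lifted arrangement; the classes are the relatively open faces *)
Definition same_face (x y : V) : Prop :=
  forall (l : {scalar V}) (c : R), lifted_arrangement [set z | l z = c] ->
    Num.sg (l x - c) = Num.sg (l y - c).

Definition faces : set (set V) := range (fun x => [set y | same_face x y]).

Definition translate (v : 'rV[int]_d) (P : set V) : set V :=
  [set x + map_mx intr v | x in P].

Definition face_orbit (P : set V) : set (set V) :=
  range (fun v => translate v P).

Definition pair_orbit (P Q : set V) : set (set V * set V) :=
  range (fun v => (translate v P, translate v Q)).

Definition toric_cell := {O : set (set V) | exists2 P, faces P & O = face_orbit P}.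

Definition is_toric_hom (F G : toric_cell) (m : set (set V * set V)) : Prop :=
  exists P Q, [/\ faces P /\ faces Q, sval F P, sval G Q, P `<=` closure Q
               & m = pair_orbit P Q].

Definition toric_hom (F G : toric_cell) :=
  {m : set (set V * set V) | is_toric_hom F G m}.

Definition comp_orbits (m1 m2 : set (set V * set V)) : set (set V * set V) :=
  [set PS | exists2 Q, m1 (PS.1, Q) & m2 (Q, PS.2)].

Lemma translateE v P : translate v P = [set x | P (x - map_mx intr v)].
Proof.
apply/seteqP; split=> x; first by case=> y Py <- /=; rewrite addrK.
by move=> Px; exists (x - map_mx intr v); rewrite // subrK.
Qed.

Lemma translate0 P : translate 0 P = P.
Proof. by rewrite translateE; apply/seteqP; split=> x /=; rewrite map_mx0 subr0. Qed.

Lemma translateD u v P : translate u (translate v P) = translate (u + v) P.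
Proof.
by rewrite !translateE; apply/seteqP; split=> x /=; rewrite map_mxD opprD addrA.
Qed.

Lemma closure_translate v P : translate v (closure P) `<=` closure (translate v P).
Proof.
move=> _ [x cx <-] U nU.
have H : (fun z : V => z + map_mx intr v) @ x --> x + map_mx intr v.
  by apply: (@cvgD R V V (nbhs x) _ id (cst _)); [exact: cvg_id|exact: cvg_cst].
by have [z [Pz Uz]] := cx _ (H _ nU); exists (z + map_mx intr v); split=> //; exists z.
Qed.

Lemma circle_piB : zmod_morphism (@circle_pi R).
Proof. by move=> x y; rewrite /circle_pi !piE. Qed.
HB.instance Definition _ :=
  GRing.isZmodMorphism.Build R (circle R) (@circle_pi R) circle_piB.

Lemma circle_pi_eq (s t : R) :
  (circle_pi s = circle_pi t) <-> exists z : int, s - t = z%:~R.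
Proof.
split=> [/eqP|[z E]].
  by rewrite /circle_pi -Quotient.idealrBE => /intrP.
by apply/eqP; rewrite /circle_pi -Quotient.idealrBE; apply/intrP; exists z.
Qed.

Lemma column_form_pi j (x : V) :
  column_form A j (torus_pi x) = circle_pi (column_form A j x).
Proof.
by rewrite /column_form raddf_sum; apply: eq_bigr => k _; rewrite !mxE raddfMz.
Qed.

Lemma column_form_linear j : linear (column_form A j : V -> R^o).
Proof.
move=> a x y; rewrite /column_form scaler_sumr -big_split /=.
by apply: eq_bigr => k _; rewrite !mxE mulrzDl /GRing.scale /= mulrzAr.
Qed.
HB.instance Definition _ j := GRing.isLinear.Build R V R^o _
  (column_form A j : V -> R^o) (column_form_linear j).

Lemma column_form_int j (v : 'rV[int]_d) :
  column_form A j (map_mx intr v : V) = (column_form A j v)%:~R.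
Proof.
rewrite /column_form rmorph_sum; apply: eq_bigr => k _.
by rewrite mxE rmorphMz.
Qed.

Lemma column_form_continuous j : continuous (column_form A j : V -> R).
Proof.
move=> x.
have -> : (column_form A j : V -> R) =
    \sum_(k < d) (fun y : V => y 0 k * (A k j)%:~R).
  by apply/funext => y; rewrite fct_sumE; apply: eq_bigr => k _; rewrite mulrzr.
elim/big_ind: _ => [|f g cf cg|k _]; first exact: cst_continuous.
  exact: (@cvgD R R V (nbhs x)).
by apply: (@cvgM R V (nbhs x)); [exact: coord_continuous|exact: cvg_cst].
Qed.

Lemma component_hyperplane j (x : V) : circle_pi (column_form A j x) = b j ->
  connected_component (torus_pi @^-1` toric_hyperplane j) x =
  [set z | column_form A j z = column_form A j x].
Proof.
move=> xj; apply/seteqP; split=> [y [C [Cx CH cC] Cy]|y /= yx].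
  have /connected_intervalP iC : connected (column_form A j @` C).
    apply: connected_continuous_connected => //.
    exact/continuous_subspaceT/column_form_continuous.
  have int_diff u v : C u -> C v ->
      exists z : int, column_form A j u - column_form A j v = z%:~R.
    move=> /CH; rewrite /preimage /toric_hyperplane /= column_form_pi => ub.
    move=> /CH; rewrite /preimage /toric_hyperplane /= column_form_pi => vb.
    by apply/circle_pi_eq; rewrite ub vb.
  have no_lt u v : C u -> C v -> column_form A j u < column_form A j v -> False.
    move=> Cu Cv uv; have [z zE] := int_diff _ _ Cv Cu.
    have z1 : 1 <= z%:~R :> R.
      by rewrite ler1z -gtz0_ge1 -(ltr0z R) -zE subr_gt0.
    have [|||w Cw wE] := iC (column_form A j u) (column_form A j v) _ _
        (column_form A j u + 2^-1).
    - by exists u.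
    - by exists v.
    - by rewrite -zE in z1; apply/andP; split; lra.
    have [z' z'E] := int_diff _ _ Cw Cu.
    have : 2 * z'%:~R = 1 :> R by rewrite -z'E wE; field.
    by rewrite -[2]/(2%:~R) -intrM => /eqP; rewrite -[1]/(1%:~R) eqr_int; lia.
  by apply/eqP; case: ltgtP => // H; [case: (no_lt y x)|case: (no_lt x y)].
pose c (s : R) : V := x + s *: (y - x).
exists (c @` `[0, 1]); last first.
  exists 1 => /=; first by rewrite in_itv /= lexx ler01.
  by rewrite /c scale1r addrC subrK.
split.
- exists 0 => /=; first by rewrite in_itv /= lexx ler01.
  by rewrite /c scale0r addr0.
- move=> _ [s _ <-]; rewrite /preimage /toric_hyperplane /= column_form_pi -xj.
  congr circle_pi; rewrite /c (linearD (column_form A j : V -> R^o)).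
  by rewrite linearZ (linearB (column_form A j : V -> R^o)) /= yx subrr scaler0 addr0.
- apply: connected_continuous_connected; first exact: segment_connected.
  apply: continuous_subspaceT => s.
  apply: (@cvgD R V R (nbhs s) _ (cst x)); first exact: cvg_cst.
  by apply: (@cvgZl R V _ (nbhs s) _ id); exact: cvg_id.
Qed.

Lemma column_form_surj j (t : R) : exists x : V, column_form A j x = t.
Proof.
have /cV0Pn[k] := ar_col_neq0 X j; rewrite mxE => Akj.
exists (\row_i (if i == k then t / (A k j)%:~R else 0)).
rewrite /column_form (bigD1 k) //= big1 => [|i /negbTE ik]; last first.
  by rewrite mxE ik mul0rz.
by rewrite mxE eqxx addr0 -mulrzr divfK // intr_eq0.
Qed.

Lemma lifted_arrangementP L : lifted_arrangement L <->
  exists j t, circle_pi t = b j /\ L = [set z | column_form A j z = t].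
Proof.
split=> [[_ [j _ <-]] [x xj ->]|[j [t [tb ->]]]].
  have {}xj : circle_pi (column_form A j x) = b j by rewrite -column_form_pi.
  by exists j, (column_form A j x); rewrite component_hyperplane.
have [x xt] := column_form_surj j t; rewrite -xt in tb *.
exists (toric_hyperplane j); first by exists j.
exists x; first by rewrite /toric_hyperplane /preimage /= column_form_pi.
by rewrite component_hyperplane.
Qed.

Lemma same_face_translate (v : 'rV[int]_d) x y : same_face x y ->
  same_face (x + map_mx intr v) (y + map_mx intr v).
Proof.
move=> xy l c /lifted_arrangementP[j [t [tb LE]]].
rewrite !linearD /=; set lv := l (map_mx _ _).
suff : lifted_arrangement [set z | l z = c - lv].
  by move=> /xy; rewrite !opprB !addrA.
apply/lifted_arrangementP; exists j, (t - column_form A j (map_mx intr v)).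
split.
  rewrite -tb; apply/circle_pi_eq; exists (- column_form A j v).
  by rewrite column_form_int rmorphN addrAC subrr add0r.
have LE' z : (l z = c) = (column_form A j z = t).
  by have := congr1 (fun S => S z) LE.
apply/seteqP; split=> z /= E.
  have /= := LE' (z + map_mx intr v); rewrite linearD E -/lv subrK => LE1.
  have : column_form A j (z + map_mx intr v) = t by rewrite -LE1.
  by move=> <-; rewrite (linearD (column_form A j : V -> R^o)) /= addrK.
have /= := LE' (z + map_mx intr v).
rewrite (linearD (column_form A j : V -> R^o)) /= E subrK => LE1.
have : l (z + map_mx intr v) = c by rewrite LE1.
by move=> <-; rewrite linearD addrK.
Qed.

Lemma faces_translate v P : faces P -> faces (translate v P).
Proof.
move=> [x _ <-]; exists (x + map_mx intr v) => //; rewrite translateE.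
apply/seteqP; split=> y /=.
  by move=> /(same_face_translate (- v)); rewrite map_mxN addrK.
by move=> /(same_face_translate v); rewrite subrK.
Qed.

Lemma translate_fix w P : faces P -> translate w P = P -> w = 0.
Proof.
move=> [x _ <-] wP; apply/eqP/negPn/negP => w0.
have /existsP[j wj] : [exists j, column_form A j w != 0].
  apply: contraT => /existsPn wA; exfalso.
  have free : row_free (map_mx intr A : 'M[rat]_(d, n)).
    by rewrite /row_free ar_mx_rank.
  have /eqP/rowP wr0 : map_mx intr w == 0 :> 'rV[rat]_d.
    rewrite -(mulmx_free_eq0 _ free) -map_mxM; apply/eqP/rowP => j; rewrite !mxE.
    have /negPn/eqP := wA j; rewrite /column_form => wj.
    rewrite (_ : \sum_k _ = 0) // -[RHS]wj; apply: eq_bigr => k _.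
    by rewrite -mulrzr intz.
  move/eqP: w0; apply; apply/rowP => k; have := wr0 k; rewrite !mxE => /eqP.
  by rewrite intr_eq0 => /eqP.
have : translate w [set y | same_face x y] (x + map_mx intr w).
  by exists x => // l c.
rewrite wP => /= xw.
have side (q : int) : let t := repr (b j) + q%:~R in
    Num.sg (column_form A j x - t) =
    Num.sg (column_form A j x + (column_form A j w)%:~R - t).
  move=> t; have := xw (column_form A j : V -> R^o) t.
  rewrite (linearD (column_form A j : V -> R^o)) /= column_form_int; apply.
  apply/lifted_arrangementP; exists j, t; split=> //.
  rewrite -[RHS]reprK; apply/circle_pi_eq; exists q.
  by rewrite /t addrC addKr.
set z := column_form A j w in wj side.
set u := column_form A j x in side.
have [q [q0 q1]] : exists q : int,
    0 <= u - (repr (b j) + q%:~R) /\ u - (repr (b j) + q%:~R) < 1.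
  exists (Num.floor (u - repr (b j))).
  have /andP[] := floor_itv (u - repr (b j)); rewrite intrD => f1 f2.
  by split; lra.
have [zn|zp|z0] := ltrgtP z 0; last by rewrite z0 eqxx in wj.
  have zR : z%:~R <= -1 :> R by rewrite (_ : -1 = (-1)%:~R) ?ler_int //; lia.
  have := side q; rewrite /= [RHS]ltr0_sg; last by lra.
  by move=> E; have := sgr_lt0 (u - (repr (b j) + q%:~R)); rewrite E ltrN10; lra.
have zR : 1 <= z%:~R :> R by rewrite ler1z; lia.
have := side (q + 1); rewrite /= intrD [LHS]ltr0_sg; last by lra.
move=> E; have := sgr_lt0 (u + z%:~R - (repr (b j) + (q%:~R + 1%:~R))).
by rewrite -E ltrN10; lra.
Qed.

Lemma translate_inj u v P : faces P -> translate u P = translate v P -> u = v.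
Proof.
move=> fP uv; apply/eqP; rewrite -subr_eq0; apply/eqP.
apply: (translate_fix fP).
by rewrite addrC -translateD uv translateD addNr translate0.
Qed.

Lemma toric_id_subproof (F : toric_cell) :
  is_toric_hom F F [set PQ | sval F PQ.1 /\ PQ.2 = PQ.1].
Proof.
have [P fP FE] := svalP F; exists P, P; rewrite FE; split=> //.
- by exists 0; rewrite ?translate0.
- by exists 0; rewrite ?translate0.
- exact: subset_closure.
apply/seteqP; split=> [[Q Q'] /= [[v _ <-] ->]|_ [v _ <-]]; first by exists v.
by split=> //; exists v.
Qed.

Definition toric_id (F : toric_cell) : toric_hom F F :=
  exist _ _ (toric_id_subproof F).

Lemma toric_comp_subproof (F G H : toric_cell) (f : toric_hom F G)
  (g : toric_hom G H) : is_toric_hom F H (comp_orbits (sval f) (sval g)).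
Proof.
have [P [Q [[fP fQ] FP GQ PQ ->]]] := svalP f.
have [Q' [S [[fQ' fS] GQ' HS QS ->]]] := svalP g.
have [w QE] : exists w, Q = translate w Q'.
  move: GQ GQ'; have [G0 _ ->] := svalP G => -[u _ <-] [v _ <-]; exists (u - v).
  by rewrite translateD subrK.
exists P, (translate w S); split=> //.
- by split=> //; exact: faces_translate.
- move: HS; have [S0 _ ->] := svalP H => -[v _ <-]; exists (w + v) => //.
  by rewrite translateD.
- apply: (subset_trans PQ); rewrite QE.
  rewrite ((closure_id _).1 (@closed_closure _ (translate w S))).
  apply: closureS => _ [x Qx <-]; apply: closure_translate.
  by exists x => //; exact: QS.
apply/seteqP; split.
  move=> [P1 S1] /= [Q1 [u _ [<- <-]] [v _ [QE1 <-]]]; exists u => //=.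
  congr pair; rewrite translateD.
  have -> // : v = u + w.
  by apply: (translate_inj fQ'); rewrite QE1 QE translateD.
move=> _ [u _ <-] /=; exists (translate u Q); first by exists u.
by exists (u + w) => //; rewrite QE !translateD.
Qed.

Definition toric_comp (F G H : toric_cell) (f : toric_hom F G)
    (g : toric_hom G H) : toric_hom F H :=
  exist _ _ (toric_comp_subproof f g).

(* The face category of the toric arrangement.  The composite of the orbits of
   (P, Q) and (Q, S) is the orbit of (P, S): as Z^d acts freely on faces, it is
   the composite of the two orbits as relations. *)
Definition toric_face_category : category.
Proof.
refine (@Category toric_cell toric_hom toric_id toric_comp _ _ _).
- move=> F G [m mP]; apply: eq_exist => /=; have [P [Q [_ FP _ _ ->]]] := mP.
  apply/seteqP; split=> [[P1 Q1] /= [P2 [_ /= ->] //]|_ [v _ <-] /=].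
  exists (translate v P) => /=; last by exists v.
  split=> //; move: FP; have [P0 _ ->] := svalP F => -[u _ <-].
  by exists (v + u); rewrite ?translateD.
- move=> F G [m mP]; apply: eq_exist => /=; have [P [Q [_ _ GQ _ ->]]] := mP.
  apply/seteqP; split=> [[P1 Q1] /= [P2 + [_ /= ->]] //|_ [v _ <-] /=].
  exists (translate v Q) => /=; first by exists v.
  split=> //; move: GQ; have [P0 _ ->] := svalP G => -[u _ <-].
  by exists (v + u); rewrite ?translateD.
- move=> F G H I [f fP] [g gP] [h hP]; apply: eq_exist; rewrite /comp_orbits /=.
  apply/seteqP; split=> -[P S] /=.
    by move=> [Q fQ [T gT hT]]; exists T => //; exists Q.
  by move=> [T [Q fQ gT] hT]; exists Q => //; exists T.
Defined.

(* the open cell of (S^1)^d given by an orbit of faces *)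
Definition cell_image (F : toric_cell) : set 'rV[circle R]_d :=
  \bigcup_(P in sval F) (torus_pi @` P).

Definition support (F : toric_cell) : set (set 'rV[circle R]_d) :=
  [set H | toric_arrangement H /\ cell_image F `<=` H].

(* The category associated with the elliptic arrangement is defined through the
   toric arrangement with the same A and b; omega does not enter. *)
Definition K_category : category :=
  @full_subcategory
    (prod_category (op_category toric_face_category)
                   (op_category toric_face_category))
    (fun FG => support FG.1 `&` support FG.2 = set0).

End Arrangements.

(* Main.v *)
From HB Require Import structures.
Require Import Defs.
From mathcomp Require Import all_boot all_order all_algebra.
From mathcomp Require Import all_classical all_reals all_analysis.
From mathcomp Require Import ring lra zify.

Set Implicit Arguments.
Unset Strict Implicit.
Unset Printing Implicit Defensive.

Import Order.TTheory GRing.Theory Num.Theory numFieldNormedType.Exports.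

Local Open Scope classical_set_scope.
Local Open Scope ring_scope.

(** Let the form <a_j, z> - b_j be the height of z above the j-th family of
parallel hyperplanes.  The function Phi (z) = sum_j psi (<a_j, z> - b_j), where
psi is the convex piecewise linear function whose slope on the interval
(k - 1, k) is k, is linear exactly on the chambers of the lifted arrangement.
Its subdifferential at z is the zonotope
  tile z = { sum_j s_j a_j | ceil h_j <= s_j <= floor h_j + 1 },
with h_j the height of z; it depends only on the face containing z.  These
zonotopes form the polyhedral subdivision dual to the arrangement: the faces of
[tile z] are the zonotopes [tile z'] with z in the closure of the face of z'
([face_tileP]), their relative interiors are disjoint ([open_tile_le], by
monotonicity of the subdifferential) and cover every tile ([tile_cover], by
Tucker's theorem of the alternative).

Translating z by an integer vector v adds <a_j, v> to the j-th height, hence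
translates its tile by the integer vector sum_j <a_j, v> a_j, written
[period v].  So the classes of points modulo periods carry a polyhedral complex
whose cells are tiles of representatives of the faces modulo Z^d and whose
attaching maps are quotient maps.  It is Hausdorff because the periods form a
discrete group.  A face map commutes with the quotient maps, so it moves points
by periods, continuously on a connected polytope: it is the translation by one
period ([face_mapP]).  Hence the face maps from the tile of z' to the tile of z
correspond to the integer vectors v with z in the closure of the face of
z' + v.  These are the morphisms, in the opposite of the toric face category,
from the cell of z' to the cell of z: Z^d acts freely on the faces, so such a
morphism determines its vector v.  Composition adds the vectors.

The product of two copies of this dual complex is again a dual complex, that of
the arrangement in R^(d + d) given by the vectors (a_j, 0) and (0, a_j).
Supports shrink from a cell to the cells having it in their closure
([supportS]), so the pairs of cells with disjoint supports are closed under
passing to faces of the dual tiles and span a subcomplex.  Its face category is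
K. *)

(** * The standard scalar product and Tucker's theorem *)

Section Dot.
Variables (R : realType) (m : nat).
Local Notation V := 'rV[R]_m.

Definition dot (v u : V) : R := \sum_k v 0 k * u 0 k.

Lemma dot_is_linear v : scalar (dot v).
Proof.
move=> t x y; rewrite /dot mulr_sumr -big_split /=; apply: eq_bigr => k _.
by rewrite !mxE; ring.
Qed.
HB.instance Definition _ v :=
  GRing.isLinear.Build R V R *%R (dot v) (dot_is_linear v).

Lemma dotC u v : dot u v = dot v u.
Proof. by apply: eq_bigr => k _; rewrite mulrC. Qed.

Lemma dotDl u v w : dot (u + v) w = dot u w + dot v w.
Proof. by rewrite dotC linearD -!(dotC w). Qed.

Lemma dotZl t u w : dot (t *: u) w = t * dot u w.
Proof. by rewrite dotC linearZ -(dotC w). Qed.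

Lemma dot0l w : dot 0 w = 0.
Proof. by rewrite dotC linear0. Qed.

Lemma dotNl u w : dot (- u) w = - dot u w.
Proof. by rewrite dotC linearN -(dotC w). Qed.

Lemma dot_suml (I : Type) (r : seq I) (P : pred I) (F : I -> V) w :
  dot (\sum_(i <- r | P i) F i) w = \sum_(i <- r | P i) dot (F i) w.
Proof. by rewrite dotC linear_sum; apply: eq_bigr => i _; rewrite dotC. Qed.

Lemma dot_gt0 v : v != 0 -> 0 < dot v v.
Proof.
move=> v0; have sq k : 0 <= v 0 k * v 0 k by rewrite -expr2 sqr_ge0.
rewrite lt_neqAle sumr_ge0 // andbT eq_sym; apply: contra v0 => /eqP E.
apply/eqP/rowP => k; have /eqP :=
  @psumr_eq0P _ _ xpredT _ (fun k _ => sq k) E k isT.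
by rewrite mulf_eq0 orbb mxE => /eqP.
Qed.

Lemma dot_rep (l : {scalar V}) : exists u, forall x, l x = dot u x.
Proof.
exists (\row_k l (delta_mx 0 k)) => x.
rewrite [in LHS](row_sum_delta x) linear_sum; apply: eq_bigr => k _.
by rewrite linearZ mxE mulrC.
Qed.

(** Strict complementarity at a single index, by induction on the other vectors.
If the vector u found for the first ones is negative on the new vector v k, then
v k is added to each v i with the multiplicity that makes it orthogonal to u,
and the induction hypothesis is applied to these corrected vectors. *)
Lemma tucker_at (I : eqType) (i0 : I) (s : seq I) (v : I -> V) :
  uniq (i0 :: s) -> exists (u : V) (c : I -> R),
  [/\ forall i, 0 <= c i, \sum_(i <- i0 :: s) c i *: v i = 0,
      forall i, i \in i0 :: s -> 0 <= dot (v i) u & 0 < c i0 + dot (v i0) u].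
Proof.
elim: s v => [|k s IH] v.
  move=> _; have [v0|v0] := eqVneq (v i0) 0.
    exists 0, (fun=> 1); split=> //.
    - by rewrite big_seq1 v0 scaler0.
    - by move=> i _; rewrite linear0.
    - by rewrite linear0 addr0.
  exists (v i0), (fun=> 0); split=> //.
  - by rewrite big_seq1 scale0r.
  - by move=> i; rewrite inE => /eqP ->; exact/ltW/dot_gt0.
  - by rewrite add0r dot_gt0.
rewrite /= inE negb_or -andbA => /and4P[i0k i0s ks us].
have us' : uniq (i0 :: s) by rewrite /= i0s.
have nk i : i \in i0 :: s -> i != k.
  rewrite inE => /orP[/eqP -> //|si].
  by apply: contraNneq ks => <-.
have swap (F : I -> V) : \sum_(i <- [:: i0, k & s]) F i =
  F k + \sum_(i <- i0 :: s) F i.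
  by rewrite !big_cons addrCA.
have mem i : (i \in [:: i0, k & s]) = (i == k) || (i \in i0 :: s).
  by rewrite !inE orbCA.
have [u [c [c0 cv vu c1]]] := IH v us'.
have [ku|ku] := leP 0 (dot (v k) u).
  exists u, (fun i => if i == k then 0 else c i); split.
  - by move=> i; case: ifP.
  - rewrite swap eqxx scale0r add0r -[RHS]cv big_seq [RHS]big_seq.
    by apply: eq_bigr => i /nk/negbTE ->.
  - by move=> i; rewrite mem => /orP[/eqP -> //|/vu].
  - by rewrite (negbTE i0k).
pose l i := - dot (v i) u / dot (v k) u.
have l0 i : i \in i0 :: s -> 0 <= l i.
  by move=> /vu iu; rewrite /l -mulrNN opprK -invrN divr_ge0 // oppr_ge0 ltW.
have [u' [c' [c'0 cb bu' c'1]]] := IH (fun i => v i + l i *: v k) us'.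
(* adding a multiple of u changes no product with a corrected vector, and this
   multiple makes the product with v k vanish *)
pose u2 := u' - (dot (v k) u' / dot (v k) u) *: u.
have ku2 : dot (v k) u2 = 0.
  by rewrite linearB linearZ /= divfK ?subrr // lt_eqF.
have iu2 i : dot (v i) u2 = dot (v i + l i *: v k) u'.
  rewrite linearB linearZ /= dotDl dotZl /l.
  by ring.
exists u2, (fun i => if i == k then \sum_(i <- i0 :: s) c' i * l i else c' i);
  split.
- move=> i; case: ifP => // _; rewrite big_seq; apply: sumr_ge0 => j /l0 lj.
  by rewrite mulr_ge0.
- rewrite swap eqxx -[RHS]cb scaler_suml addrC.
  rewrite big_seq [X in _ + X]big_seq [RHS]big_seq -big_split /=.
  by apply: eq_bigr => i /nk/negbTE ->; rewrite scalerDr scalerA.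
- by move=> i; rewrite mem => /orP[/eqP ->|/bu']; rewrite ?ku2 // iu2.
- by rewrite (negbTE i0k) iu2.
Qed.

(** Strict complementarity at all indices: the solutions obtained for the
single ones are summed. *)
Lemma tucker (I : finType) (v : I -> V) : exists (u : V) (c : I -> R),
  [/\ forall i, 0 <= c i, \sum_i c i *: v i = 0,
      forall i, 0 <= dot (v i) u & forall i, 0 < c i + dot (v i) u].
Proof.
have /choice[uc ucP] i0 : exists uc : V * (I -> R),
    [/\ forall i, 0 <= uc.2 i, \sum_i uc.2 i *: v i = 0,
      forall i, 0 <= dot (v i) uc.1 & 0 < uc.2 i0 + dot (v i0) uc.1].
  have pe : perm_eq (index_enum I) (i0 :: rem i0 (index_enum I)).
    exact/perm_to_rem/mem_index_enum.
  have [|u [c [c0 cv vu c1]]] := @tucker_at I i0 (rem i0 (index_enum I)) v.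
    by rewrite -(perm_uniq pe) index_enum_uniq.
  exists (u, c); split=> //=; first by rewrite (perm_big _ pe).
  by move=> i; apply: vu; rewrite -(perm_mem pe) mem_index_enum.
exists (\sum_i (uc i).1), (fun i => \sum_k (uc k).2 i).
have c0 k i : 0 <= (uc k).2 i by have [] := ucP k.
have vu k i : 0 <= dot (v i) (uc k).1 by have [] := ucP k.
split=> [i| |i|i].
- by apply: sumr_ge0.
- under eq_bigr do rewrite scaler_suml.
  by rewrite exchange_big big1 //= => k _; have [] := ucP k.
- by rewrite linear_sum; apply: sumr_ge0 => k _; exact: vu.
- rewrite linear_sum -big_split /= (bigD1 i) //= ltr_wpDr //.
    by apply: sumr_ge0 => k _; rewrite addr_ge0.
  by have [] := ucP i.
Qed.

End Dot.

(** * Rounding *)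

Section Rounding.
Variable R : realType.
Implicit Types t w d : R.

Lemma ceil_le_floorD1 t : Num.ceil t <= Num.floor t + 1.
Proof. by rewrite ceil_le_int ltW // floorD1_gt. Qed.

Lemma floorD1_le_ceil t t' : t < t' -> Num.floor t + 1 <= Num.ceil t'.
Proof.
move=> tt'; have : Num.floor t < Num.ceil t'.
  by rewrite -(ltr_int R) (le_lt_trans (floor_le t)) // (lt_le_trans tt')
    ?ceil_ge.
lia.
Qed.

Lemma ceil_lt_floorD1 t : Num.ceil t < Num.floor t + 1 ->
  t = (Num.ceil t)%:~R /\ Num.floor t + 1 = Num.ceil t + 1.
Proof.
move=> cf; have fc : Num.floor t <= Num.ceil t.
  by rewrite -(ler_int R) (le_trans (floor_le t)) ?ceil_ge.
have E : Num.floor t = Num.ceil t by lia.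
split; last by rewrite E.
by apply/eqP; rewrite eq_le ceil_ge /= -E floor_le.
Qed.

Lemma near_ceil t w : 0 < w -> \forall d \near 0^'+,
  Num.ceil (t - d * w) = Num.ceil t /\ Num.floor (t - d * w) + 1 = Num.ceil t.
Proof.
move=> w0; have e0 : 0 < (t - (Num.ceil t - 1)%:~R) / w.
  by rewrite divr_gt0 // subr_gt0 ceilB1_lt.
near=> d; have d0 : 0 < d by near: d; exact: nbhs_right_gt.
have : d < (t - (Num.ceil t - 1)%:~R) / w by near: d; exact: nbhs_right_lt.
rewrite ltr_pdivlMr // => dw; have dw0 : 0 < d * w by rewrite mulr_gt0.
have tc := ceil_ge t.
have [l1 l2] : (Num.ceil t - 1)%:~R < t - d * w /\ t - d * w < (Num.ceil t)%:~R.
  by split; lra.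
split; first by apply: Num.Theory.ceil_def; rewrite l1 ltW.
rewrite (@Num.Theory.floor_def _ _ (Num.ceil t - 1)) ?subrK //.
by rewrite ltW.
Unshelve. all: by end_near. Qed.

Lemma near_floor t w : w < 0 -> \forall d \near 0^'+,
  Num.ceil (t - d * w) = Num.floor t + 1 /\
  Num.floor (t - d * w) + 1 = Num.floor t + 1.
Proof.
move=> w0; have e0 : 0 < ((Num.floor t + 1)%:~R - t) / - w.
  by rewrite divr_gt0 ?oppr_gt0 // subr_gt0 floorD1_gt.
near=> d; have d0 : 0 < d by near: d; exact: nbhs_right_gt.
have : d < ((Num.floor t + 1)%:~R - t) / - w by near: d; exact: nbhs_right_lt.
rewrite ltr_pdivlMr ?oppr_gt0 // => dw.
have dw0 : d * w < 0 by rewrite pmulr_rlt0.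
have tc := floor_le t.
have [l1 l2] : (Num.floor t)%:~R < t - d * w /\
    t - d * w < (Num.floor t + 1)%:~R by split; lra.
split; first by apply: Num.Theory.ceil_def; rewrite addrK l1 ltW.
by rewrite (@Num.Theory.floor_def _ _ (Num.floor t)) // ltW.
Unshelve. all: by end_near. Qed.

(** If s is in the closure of the stratum of t, an open interval between
integers or a single integer, then a point moving from s to t enters this
stratum at once. *)
Lemma round_segment (s t e : R) :
  Num.ceil s <= Num.ceil t -> Num.floor t <= Num.floor s -> 0 < e < 1 ->
  Num.ceil (s + e * (t - s)) = Num.ceil t /\ Num.floor (s + e * (t - s)) =
    Num.floor t.
Proof.
move=> cs fs /andP[e0 e1].
have s1 : s <= (Num.ceil t)%:~R by rewrite -ceil_le_int.
have s2 : (Num.floor t)%:~R <= s by rewrite -floor_ge_int.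
have t1 := ceil_ge t; have t2 := floor_le t.
have := ceil_le_floorD1 t;
  rewrite le_eqVlt => /orP[/eqP ct|/ceil_lt_floorD1[tE ft]]; last first.
  have E : Num.floor t = Num.ceil t by lia.
  have -> : s = t by rewrite E in s2; lra.
  by rewrite subrr mulr0 addr0.
have ctR : (Num.ceil t)%:~R = (Num.floor t)%:~R + 1 :> R by rewrite ct intrD.
have t3 : (Num.floor t)%:~R < t by have := ceilB1_lt t; rewrite intrB ctR; lra.
have t4 : t < (Num.floor t)%:~R + 1 by have := floorD1_gt t; rewrite intrD.
have E : s + e * (t - s) = (1 - e) * s + e * t by ring.
have l1 : (Num.floor t)%:~R < s + e * (t - s).
  have p1 : 0 <= (1 - e) * (s - (Num.floor t)%:~R) by rewrite mulr_ge0; lra.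
  have p2 : 0 < e * (t - (Num.floor t)%:~R) by rewrite mulr_gt0; lra.
  by lra.
have l2 : s + e * (t - s) < (Num.floor t)%:~R + 1.
  have p1 : 0 <= (1 - e) * ((Num.floor t)%:~R + 1 - s) by rewrite mulr_ge0; lra.
  have p2 : 0 < e * ((Num.floor t)%:~R + 1 - t) by rewrite mulr_gt0; lra.
  by lra.
split.
  by apply: Num.Theory.ceil_def; rewrite ct addrK intrD l1 ltW.
by apply: Num.Theory.floor_def; rewrite intrD l2 ltW.
Qed.

End Rounding.

(** * The zonotopal tiles dual to an arrangement *)

Section Tiles.
Variables (R : realType) (m : nat) (J : finType).
Variables (a : J -> 'rV[int]_m) (beta : J -> R).
Local Notation V := 'rV[R]_m.
Implicit Types (z y u : V) (s : J -> R).

Definition gen j : V := map_mx intr (a j).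
Definition height j z : R := dot (gen j) z - beta j.
(** [low j z] and [high j z] bound the subdifferential of psi at the height:
they differ exactly when z lies on a hyperplane of the j-th family. *)
Definition low j z : int := Num.ceil (height j z).
Definition high j z : int := Num.floor (height j z) + 1.
Definition combo s : V := \sum_j s j *: gen j.
Definition box z : set (J -> R) :=
  [set s | forall j, (low j z)%:~R <= s j <= (high j z)%:~R].
(** Intervals reduced to a point count as open. *)
Definition open_box z : set (J -> R) :=
  [set s | box z s /\ forall j, low j z < high j z ->
                        (low j z)%:~R < s j < (high j z)%:~R].
Definition tile z : set V := combo @` box z.
Definition open_tile z : set V := combo @` open_box z.
(** The order of faces by inclusion in closures: z satisfies all the weak
inequalities between heights and integers that z' satisfies. *)
Definition cell_le z z' := forall j, low j z <= low j z' /\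
  high j z' <= high j z.

Lemma low_le_high j z : low j z <= high j z.
Proof. exact: ceil_le_floorD1. Qed.

Lemma box_low z : box z (fun j => (low j z)%:~R).
Proof. by move=> j; rewrite lexx ler_int low_le_high. Qed.

Lemma open_box_mid z :
  open_box z (fun j => ((low j z)%:~R + (high j z)%:~R) / 2).
Proof.
split=> j.
  by have := low_le_high j z; rewrite -(ler_int R) => ?; apply/andP; split; lra.
by rewrite -(ltr_int R) => ?; apply/andP; split; lra.
Qed.

Lemma tile_neq0 z : tile z !=set0.
Proof.
exists (combo (fun j => (low j z)%:~R)), (fun j => (low j z)%:~R) => //.
exact: box_low.
Qed.

Lemma open_tile_sub z : open_tile z `<=` tile z.
Proof. by move=> _ [s [bs _] <-]; exists s. Qed.

Lemma cell_le_trans z1 z2 z3 : cell_le z1 z2 -> cell_le z2 z3 -> cell_le z1 z3.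
Proof.
move=> z12 z23 j; have [l1 h1] := z12 j; have [l2 h2] := z23 j.
by split; [exact: le_trans l1 l2|exact: le_trans h2 h1].
Qed.

Lemma cell_le_box z z' : cell_le z z' -> box z' `<=` box z.
Proof.
move=> zz' s s' j; have [l h] := zz' j; have /andP[l1 h1] := s' j.
by apply/andP; split; [apply: le_trans l1|apply: (le_trans h1)];
  rewrite ler_int.
Qed.

Lemma cell_le_tile z z' : cell_le z z' -> tile z' `<=` tile z.
Proof. by move=> /cell_le_box zz' _ [s /zz' s' <-]; exists s. Qed.

(** Monotonicity of the subdifferential of psi. *)
Lemma box_monotone z z' s s' j : box z s -> box z' s' ->
  0 <= (s j - s' j) * (height j z - height j z').
Proof.
move=> /(_ j)/andP[l h] /(_ j)/andP[l' h'].
have [zz'|zz'|->] := ltgtP (height j z) (height j z');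
  last by rewrite subrr mulr0.
- have := floorD1_le_ceil zz'; rewrite -/(high j z) -/(low j z') -(ler_int R) =>
  ?.
  by rewrite mulr_le0 // subr_le0; lra.
- have := floorD1_le_ceil zz'; rewrite -/(high j z') -/(low j z) -(ler_int R) =>
  ?.
  by rewrite mulr_ge0 // subr_ge0; lra.
Qed.

Lemma comboD s s' : combo (fun j => s j + s' j) = combo s + combo s'.
Proof. by rewrite -big_split; apply: eq_bigr => j _; rewrite scalerDl. Qed.

Lemma comboB s s' : combo (fun j => s j - s' j) = combo s - combo s'.
Proof. by rewrite -sumrB; apply: eq_bigr => j _; rewrite scalerBl. Qed.

Lemma comboZ t s : combo (fun j => t * s j) = t *: combo s.
Proof. by rewrite scaler_sumr; apply: eq_bigr => j _; rewrite scalerA. Qed.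

Lemma combo_sum (I : Type) (r : seq I) (F : I -> J -> R) :
  combo (fun j => \sum_(i <- r) F i j) = \sum_(i <- r) combo (F i).
Proof. by rewrite exchange_big; apply: eq_bigr => j _; rewrite scaler_suml. Qed.

Lemma dot_combo s u : dot (combo s) u = \sum_j s j * dot (gen j) u.
Proof. by rewrite dot_suml; apply: eq_bigr => j _; rewrite dotZl. Qed.

Lemma heightB j z z' : height j z - height j z' = dot (gen j) (z - z').
Proof. by rewrite /height linearB /=; ring. Qed.

Lemma dot_comboB s s' z z' : dot (combo s - combo s') (z - z') =
  \sum_j (s j - s' j) * (height j z - height j z').
Proof. by rewrite -comboB dot_combo; apply: eq_bigr => j _; rewrite heightB.
Qed.

(** A sum of nonnegative terms vanishes only termwise. *)
Lemma box_orthogonal z z' s s' : box z s -> box z' s' ->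
  dot (combo s - combo s') (z - z') = 0 ->
  forall j, height j z = height j z' \/ s j = s' j.
Proof.
move=> bs bs' /eqP; rewrite dot_comboB => /eqP S0 j.
have /eqP := @psumr_eq0P _ _ xpredT _ (fun j _ => box_monotone j bs bs') S0 j
  isT.
by rewrite mulf_eq0 !subr_eq0 => /orP[] /eqP; [right|left].
Qed.

(** A common point of the two tiles is orthogonal to z - z' in the sense of
[box_orthogonal], so for each j either the heights agree or the coefficients do.
An interior coefficient of an interval (k, k + 1) lies in no other
subdifferential of psi, so in the second case z is on no hyperplane of the j-th
family unless z' has the same height. *)
Lemma open_tile_le z z' y : open_tile z y -> tile z' y -> cell_le z' z.
Proof.
move=> [s [bs os] <-] [s' bs' E] j.
have [|e|e] := box_orthogonal bs bs' _ j; first by rewrite E subrr dot0l.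
  by rewrite /low /high e.
have /andP[l h] := bs j; have /andP[] := bs' j; rewrite -e => l' h'.
have := low_le_high j z; rewrite le_eqVlt => /orP[/eqP lh|lh].
  split; rewrite -(ler_int R); last by rewrite -lh (le_trans l).
  by rewrite lh (le_trans l').
have /andP[ls sh] := os _ lh.
have [_ hE] := ceil_lt_floorD1 lh; rewrite -/(low j z) -/(high j z) in hE.
have : low j z' < high j z by rewrite -(ltr_int R) (le_lt_trans l').
have : low j z < high j z' by rewrite -(ltr_int R) (lt_le_trans ls).
lia.
Qed.

Lemma tile_sub_le z z' : tile z' `<=` tile z -> cell_le z z'.
Proof.
move=> zz'; have := open_box_mid z'; set s := fun j => _ => os.
have oy : open_tile z' (combo s) by exists s.
exact: open_tile_le oy (zz' _ (open_tile_sub oy)).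
Qed.

(** z' results from z by a small step in the direction - u: the interval of a
height that decreases shrinks to its lower end, that of a height that increases
to its upper end. *)
Definition tilted z u z' := forall j,
  [/\ 0 < dot (gen j) u -> low j z' = low j z /\ high j z' = low j z,
      dot (gen j) u < 0 -> low j z' = high j z /\ high j z' = high j z
    & dot (gen j) u = 0 -> low j z' = low j z /\ high j z' = high j z].

Lemma tilted_exists z u : exists z', tilted z u z'.
Proof.
suff P : \forall d \near (0 : R)^'+, tilted z u (z - d *: u).
  by near (0 : R)^'+ => d; exists (z - d *: u); near: d.
apply: filter_forall => j.
have hE d : height j (z - d *: u) = height j z - d * dot (gen j) u.
  by rewrite /height linearB linearZ /=; ring.
rewrite /low /high; have [w0|w0|w0] := ltgtP (dot (gen j) u) 0.
- apply: filterS (near_floor (height j z) w0) => d E; rewrite hE; split=> //.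
  by move=> w0'; rewrite w0' ltxx in w0.
- apply: filterS (near_ceil (height j z) w0) => d E; rewrite hE; split=> //.
  by move=> w0'; rewrite w0' ltxx in w0.
- by apply: nearW => d; rewrite hE w0 mulr0 subr0.
Unshelve. all: by end_near. Qed.

Lemma tilted_le z u z' : tilted z u z' -> cell_le z z'.
Proof.
move=> pd j; have [p1 p2 p3] := pd j; have lh := low_le_high j z.
by have [/p2[-> ->]|/p1[-> ->]|/p3[-> ->]] := ltgtP (dot (gen j) u) 0.
Qed.

(** A form u is minimized on the tile where each coefficient s_j is at the end
of its interval prescribed by the sign of <a_j, u>, so its minimum face is the
tile of any point tilted by u. *)
Lemma face_of_tile z F : is_face (tile z) F ->
  exists2 z', cell_le z z' & F = tile z'.
Proof.
move=> [[y0 Fy0] [l [c [lc FE]]]].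
have [u uE] := dot_rep l.
have [z' pd] := tilted_exists z u; exists z'; first exact: tilted_le pd.
have lE s : l (combo s) = \sum_j s j * dot (gen j) u
  by rewrite uE dotC dot_combo.
move: Fy0; rewrite FE => -[[s0 bs0 <-] ls0].
(* s1 minimizes the form termwise; it agrees with the minimizer s0 where the
   form gives no preference *)
pose s1 j := if 0 < dot (gen j) u then (low j z)%:~R else
             if dot (gen j) u < 0 then (high j z)%:~R else s0 j.
have lh j := low_le_high j z.
have bs1 : box z s1.
  by move=> j; rewrite /s1; do 2?case: ifP => _; rewrite ?lexx ?ler_int ?lh //;
    exact: bs0.
have s1min s j : box z s -> 0 <= (s j - s1 j) * dot (gen j) u /\
    (dot (gen j) u = 0 \/ ((s j - s1 j) * dot (gen j) u = 0 -> s j = s1 j)).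
  move=> /(_ j)/andP[ls hs]; rewrite /s1.
  have [w0|w0|->] := ltgtP (dot (gen j) u) 0; last by rewrite mulr0; split;
    [|left].
    split; first by rewrite mulr_le0 ?subr_le0 // ltW.
    by right=> /eqP; rewrite mulf_eq0 subr_eq0 (lt_eqF w0) orbF => /eqP.
  split; first by rewrite mulr_ge0 ?subr_ge0 // ltW.
  by right=> /eqP; rewrite mulf_eq0 subr_eq0 (gt_eqF w0) orbF => /eqP.
have ls1 : l (combo s1) = c.
  apply/eqP; rewrite eq_le lc ?andbT; last by exists s1.
  rewrite -ls0 !lE -subr_ge0 -sumrB; apply: sumr_ge0 => j _.
  by rewrite -mulrBl; have [] := s1min s0 j bs0.
apply/seteqP; split=> [_ [[s bs <-] ls]|_ [s bs <-]].
  exists s => // j; have [p1 p2 p3] := pd j.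
  have S0 : \sum_j (s j - s1 j) * dot (gen j) u = 0.
    rewrite -[RHS](subrr c) -{1}ls -{1}ls1 !lE -sumrB.
    by apply: eq_bigr => k _; rewrite mulrBl.
  have sj := @psumr_eq0P _ _ xpredT _ (fun j _ => (s1min s j bs).1) S0 j isT.
  have sE : dot (gen j) u != 0 -> s j = s1 j.
    by case: (s1min s j bs).2 => [->|/(_ sj) //]; rewrite eqxx.
  move: sE; rewrite /s1; have [w0|w0|w0] := ltgtP (dot (gen j) u) 0.
  - by have [-> ->] := p2 w0 => ->; rewrite ?lexx ?lt_eqF.
  - by have [-> ->] := p1 w0 => ->; rewrite ?lexx ?gt_eqF.
  - by have [-> ->] := p3 w0 => _; exact: (bs j).
have bzs : box z s.
  move=> j; have /andP[] := bs j; have [p1 p2 p3] := pd j.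
  have lhR : (low j z)%:~R <= (high j z)%:~R :> R by rewrite ler_int lh.
  have [w0|w0|w0] := ltgtP (dot (gen j) u) 0.
  - by have [-> ->] := p2 w0 => l1 l2; rewrite (le_trans lhR).
  - by have [-> ->] := p1 w0 => l1 l2; rewrite l1 (le_trans l2).
  - by have [-> ->] := p3 w0 => -> ->.
split; first by exists s.
rewrite -ls1 !lE; apply: eq_bigr => j _; rewrite /s1.
have /andP[] := bs j; have [p1 p2 p3] := pd j.
have [w0|w0|->] := ltgtP (dot (gen j) u) 0; last by rewrite !mulr0.
  have [-> ->] := p2 w0 => *; congr (_ * _); apply/eqP; rewrite eq_le;
    exact/andP.
have [-> ->] := p1 w0 => *; congr (_ * _); apply/eqP; rewrite eq_le; exact/andP.
Qed.

(** By monotonicity, [tile z'] is the face of [tile z] on which the form z - z'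
is minimal. *)
Lemma tile_face z z' : cell_le z z' -> is_face (tile z) (tile z').
Proof.
move=> zz'; split; first exact: tile_neq0.
pose s0 j : R := (low j z')%:~R.
have bs0 : box z' s0 := box_low z'.
have bzs0 := cell_le_box zz' bs0.
have mon s s' : box z s -> box z' s' -> dot (z - z') (combo s') <=
  dot (z - z') (combo s).
  move=> bs bs'; rewrite -subr_ge0 !(dotC (z - z')) -dotNl -dotDl dot_comboB.
  by apply: sumr_ge0 => j _; exact: box_monotone.
exists (dot (z - z')), (dot (z - z') (combo s0)); split=> [_ [s bs <-]|];
  first exact: mon.
apply/seteqP; split=> [_ [s bs <-]|_ [[s bs <-] E]].
  split; first by exists s => //; exact: cell_le_box bs.
  by apply/eqP; rewrite eq_le !mon //; exact: cell_le_box bs.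
exists s => // j.
have [|e|->] := box_orthogonal bs bs0 _ j; last exact: bs0.
  by rewrite dotDl dotNl -!(dotC (z - z')) E subrr.
by have := bs j; rewrite /low /high e.
Qed.

Lemma face_tileP z F :
  is_face (tile z) F <-> exists2 z', cell_le z z' & F = tile z'.
Proof.
by split=> [/face_of_tile //|[z' zz' ->]]; exact: tile_face.
Qed.

(** Write the point as [combo s] and apply Tucker's theorem to the directions in
which the coefficients s_j may move: + a_j below the upper end of the interval,
- a_j above the lower end.  It yields a direction u and a relation between the
allowed moves such that an s_j at an end of its interval either can be moved
inside along the relation, or has <a_j, u> <> 0.  Moving s along the relation
and tilting z by u turns s into an interior coefficient vector of the tilted
point. *)
Lemma tile_cover z y : tile z y -> exists2 z', cell_le z z' & open_tile z' y.
Proof.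
move=> [s bs <-].
pose v (i : J * bool) : V := if i.2 then
    if s i.1 < (high i.1 z)%:~R then gen i.1 else 0
  else if (low i.1 z)%:~R < s i.1 then - gen i.1 else 0.
have [u [c [c0 cv vu vcu]]] := tucker v.
pose up j : R := if s j < (high j z)%:~R then c (j, true) else 0.
pose dn j : R := if (low j z)%:~R < s j then c (j, false) else 0.
have combo0 : combo (fun j => up j - dn j) = 0.
  rewrite -[RHS]cv.
  rewrite (eq_bigr (fun i : J * bool => c (i.1, i.2) *: v (i.1, i.2)));
    last by case.
  rewrite -(pair_bigA _ (fun j b => c (j, b) *: v (j, b))) /=.
  apply: eq_bigr => j _;
    rewrite (big_bool _ (fun b => c (j, b) *: v (j, b))) /v /= scalerBl /up /dn.
  by do 2!case: ifP => _;
    rewrite ?scalerN ?scaler0 ?scale0r ?subr0 ?sub0r ?addr0 ?add0r ?oppr0.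
have upP j : s j < (high j z)%:~R -> 0 <= dot (gen j) u /\
  0 < up j + dot (gen j) u.
  by move=> sh; have := vu (j, true); have := vcu (j, true);
    rewrite /v /up /= sh.
have dnP j : (low j z)%:~R < s j -> dot (gen j) u <= 0 /\ dot (gen j) u < dn j.
  move=> sh; have := vu (j, false); have := vcu (j, false).
  by rewrite /v /dn /= sh dotNl oppr_ge0 subr_gt0.
have up0 j : 0 <= up j by rewrite /up; case: ifP.
have dn0 j : 0 <= dn j by rewrite /dn; case: ifP.
(* complementarity: both signs of the relation pair nonnegatively with u, and
   the relation sums to 0 *)
have ud0 j : up j * dot (gen j) u = 0 /\ dn j * dot (gen j) u = 0.
  have T k : 0 <= (up k - dn k) * dot (gen k) u /\ 0 <= up k * dot (gen k) u
      /\ dn k * dot (gen k) u <= 0.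
    have P1 : 0 <= up k * dot (gen k) u.
      rewrite /up; case: ifP => [/upP[w0 _]|]; last by rewrite mul0r.
      by rewrite mulr_ge0.
    have P2 : dn k * dot (gen k) u <= 0.
      rewrite /dn; case: ifP => [/dnP[w0 _]|]; last by rewrite mul0r.
      by rewrite mulr_ge0_le0.
    by split=> //; rewrite mulrBl; lra.
  have S0 : \sum_k (up k - dn k) * dot (gen k) u = 0.
    by rewrite -dot_combo combo0 dot0l.
  have := @psumr_eq0P _ _ xpredT _ (fun k _ => (T k).1) S0 j isT.
  by have [_ []] := T j; rewrite mulrBl; lra.
have [z' pd] := tilted_exists z u.
(* a step e that crosses no end of an interval *)
have [e e0 es] : exists2 e, 0 < e & forall j,
    ((low j z)%:~R < s j -> (low j z)%:~R < s j + e * (up j - dn j)) /\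
    (s j < (high j z)%:~R -> s j + e * (up j - dn j) < (high j z)%:~R).
  suff : \forall e \near (0 : R)^'+, forall j,
    ((low j z)%:~R < s j -> (low j z)%:~R < s j + e * (up j - dn j)) /\
    (s j < (high j z)%:~R -> s j + e * (up j - dn j) < (high j z)%:~R).
    move=> P; near (0 : R)^'+ => e; exists e; last by near: e.
    by near: e; exact: nbhs_right_gt.
  apply: filter_forall => j.
  have N : 0 < 1 + up j + dn j by have := up0 j; have := dn0 j; lra.
  pose slack (r : R) := if 0 < r then r / (1 + up j + dn j) else 1.
  have slack0 r : 0 < slack r by rewrite /slack; case: ifP => // r0;
    exact: divr_gt0.
  have slackP r e : 0 < r -> e < slack r -> e * (1 + up j + dn j) < r.
    by rewrite /slack => -> ; rewrite ltr_pdivlMr.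
  near=> e.
  have e0 : 0 < e by near: e; exact: nbhs_right_gt.
  have eu : 0 <= e * up j by rewrite mulr_ge0 // ltW.
  have ed : 0 <= e * dn j by rewrite mulr_ge0 // ltW.
  split=> [|] sj.
    have : e < slack (s j - (low j z)%:~R) by near: e; exact: nbhs_right_lt.
    by move/slackP; rewrite subr_gt0 => /(_ sj); lra.
  have : e < slack ((high j z)%:~R - s j) by near: e; exact: nbhs_right_lt.
  by move/slackP; rewrite subr_gt0 => /(_ sj); lra.
exists z'; first exact: tilted_le pd.
exists (fun j => s j + e * (up j - dn j)); last first.
  by rewrite comboD comboZ combo0 scaler0 addr0.
suff H j : let s' := s j + e * (up j - dn j) in
    (low j z')%:~R <= s' <= (high j z')%:~R /\
    (low j z' < high j z' -> (low j z')%:~R < s' < (high j z')%:~R).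
  by split=> j; [exact: (H j).1|exact: (H j).2].
move=> s'; have [p1 p2 p3] := pd j; have [uu dd] := ud0 j.
have /andP[ls hs] := bs j; have [es1 es2] := es j.
have [w0|w0|w0] := ltgtP (dot (gen j) u) 0.
- have [-> ->] := p2 w0; rewrite ltxx; split=> //.
  have us : s j = (high j z)%:~R.
    by apply/eqP; rewrite eq_le hs leNgt; apply/negP => /upP[]; lra.
  move/eqP: uu; rewrite mulf_eq0 (lt_eqF w0) orbF => /eqP uu.
  move/eqP: dd; rewrite mulf_eq0 (lt_eqF w0) orbF => /eqP dd.
  by rewrite /s' uu dd subrr mulr0 addr0 us lexx.
- have [-> ->] := p1 w0; rewrite ltxx; split=> //.
  have us : s j = (low j z)%:~R.
    by apply/eqP; rewrite eq_le ls andbT leNgt; apply/negP => /dnP[]; lra.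
  move/eqP: uu; rewrite mulf_eq0 (gt_eqF w0) orbF => /eqP uu.
  move/eqP: dd; rewrite mulf_eq0 (gt_eqF w0) orbF => /eqP dd.
  by rewrite /s' uu dd subrr mulr0 addr0 us lexx.
have [-> ->] := p3 w0; have := low_le_high j z;
  rewrite le_eqVlt => /orP[/eqP lh|lh].
  have [sl sh] : (low j z)%:~R = s j /\ (high j z)%:~R = s j.
    by move: ls hs; rewrite -lh => ? ?; split; apply/eqP; rewrite eq_le;
      apply/andP.
  by rewrite lh ltxx; split=> //;
    rewrite /s' /up /dn sl sh ltxx subrr mulr0 addr0 lexx.
suff E : (low j z)%:~R < s' < (high j z)%:~R by split=> //;
  have /andP[l1 l2] := E; rewrite !ltW.
have lhR : (low j z)%:~R < (high j z)%:~R :> R by rewrite ltr_int.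
have [ls'|ls'] := ltP (low j z)%:~R (s j); last first.
  have sh : s j < (high j z)%:~R by lra.
  rewrite es2 // andbT; have [_] := upP j sh; rewrite w0 addr0 => u0.
  have : 0 < e * up j by rewrite mulr_gt0.
  have -> : s' = s j + e * up j by rewrite /s' /dn ltNge ls' /= subr0.
  by lra.
rewrite es1 //=; have [sh|sh] := ltP (s j) (high j z)%:~R; first exact: es2.
have [_] := dnP j ls'; rewrite w0 => u0.
have : 0 < e * dn j by rewrite mulr_gt0.
have -> : s' = s j - e * dn j by rewrite /s' /up ltNge sh /= sub0r mulrN.
by lra.
Unshelve. all: by end_near. Qed.

End Tiles.

(** * Tiles as polytopes: vertices, relative interior, translation *)

Lemma dot_continuous (R : realType) m (v : 'rV[R]_m) :
  continuous (dot v : _ -> R).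
Proof.
move=> x.
have -> : (dot v : 'rV[R]_m -> R) = \sum_k (fun y => v 0 k * y 0 k).
  by apply/funext => y; rewrite fct_sumE.
elim/big_ind: _ => [|f g cf cg|k _]; first exact: cst_continuous.
  exact: (@cvgD R R _ (nbhs x)).
by apply: (@cvgM R _ (nbhs x)); [exact: cvg_cst|exact: coord_continuous].
Qed.

Section Hull.
Variables (R : realType) (m : nat).
Local Notation V := 'rV[R]_m.

Lemma convex_hull_vertex k (p : 'I_k -> V) i : convex_hull p (p i).
Proof.
exists (fun j => (j == i)%:R); split.
- by move=> j; rewrite ler0n.
- by rewrite (bigD1 i) //= eqxx big1 ?addr0 // => j /negbTE ->.
- rewrite (bigD1 i) //= eqxx big1 ?addr0 ?scale1r // => j /negbTE ->.
  by rewrite scale0r.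
Qed.

Lemma convex_hull_convex k (p : 'I_k -> V) x y t : 0 <= t <= 1 ->
  convex_hull p x -> convex_hull p y -> convex_hull p (t *: x + (1 - t) *: y).
Proof.
move=> /andP[t0 t1] [w [w0 w1 ->]] [w' [w'0 w'1 ->]].
exists (fun i => t * w i + (1 - t) * w' i); split.
- by move=> i; apply: addr_ge0; apply: mulr_ge0; rewrite ?subr_ge0.
- by rewrite big_split /= -!mulr_sumr w1 w'1 !mulr1 addrC subrK.
- rewrite !scaler_sumr -big_split /=; apply: eq_bigr => i _.
  by rewrite !scalerA -scalerDl.
Qed.

End Hull.

Section TileGeometry.
Variables (R : realType) (m : nat) (J : finType).
Variables (a : J -> 'rV[int]_m) (beta : J -> R).
Local Notation V := 'rV[R]_m.
Local Notation gen := (@gen R m J a).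
Local Notation combo := (@combo R m J a).
Local Notation box := (box a beta).
Local Notation tile := (tile a beta).
Local Notation open_tile := (open_tile a beta).
Local Notation lo := (low a beta).
Local Notation hi := (high a beta).
Implicit Types (z y u : V) (s : J -> R).

Definition vertex z (e : {ffun J -> bool}) : J -> R :=
  fun j => if e j then (hi j z)%:~R else (lo j z)%:~R.

Lemma vertex_box z e : box z (vertex z e).
Proof. by move=> j; rewrite /vertex; case: ifP => _;
  rewrite lexx ler_int low_le_high. Qed.

(** A box is the convex hull of its vertices: the coordinates not yet at an end
of their interval are moved to both ends, one after the other. *)
Lemma tile_polytope z : is_polytope (tile z).
Proof.
pose E := enum {ffun J -> bool}; pose e0 : {ffun J -> bool} := [ffun=> false].
exists (size E).-1, (fun i : 'I_(size E).-1.+1 =>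
  combo (vertex z (nth e0 E i))).
have mE e : e \in E by rewrite mem_enum.
have sE : (size E).-1.+1 = size E by rewrite prednK //; have := mE e0;
  case: (E).
set p := fun i => _.
have pv e : convex_hull p (combo (vertex z e)).
  have ie : (index e E < (size E).-1.+1)%N by rewrite sE index_mem.
  have -> : combo (vertex z e) = p (Ordinal ie) by rewrite /p /= nth_index.
  exact: convex_hull_vertex.
apply/seteqP; split=> [_ [s bs <-]|_ [w [w0 w1 ->]]]; last first.
  exists (fun j => \sum_i w i * vertex z (nth e0 E i) j).
    move=> j; have vb i := vertex_box z (nth e0 E (i : 'I_(size E).-1.+1)) j.
    apply/andP; split; [rewrite -[leLHS]mul1r|rewrite -[leRHS]mul1r];
      rewrite -[X in X * _]w1 mulr_suml; apply: ler_sum => i _;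
      by apply: ler_wpM2l => //; have /andP[] := vb i.
  rewrite (combo_sum _ _ (fun i j => w i * vertex z (nth e0 E i) j)).
  by apply: eq_bigr => i _; rewrite comboZ.
suff H (r : seq J) s' : box z s' ->
    (forall j, j \in r \/ s' j = (lo j z)%:~R \/ s' j = (hi j z)%:~R) ->
    convex_hull p (combo s').
  by apply: (H (enum J)) => // j; left; rewrite mem_enum.
elim: r s' => [|k r IH] s' bs' rs'.
  suff -> : s' = vertex z [ffun j => s' j == (hi j z)%:~R] by exact: pv.
  apply/funext => j; rewrite /vertex ffunE; case: eqP => // sj.
  by have [|[]] := rs' j.
have [lk|lk] := eqVneq (lo k z) (hi k z).
  apply: IH => // j; have [|] := rs' j; last by right.
  rewrite inE => /orP[/eqP ->|]; last by left.
  by right; left; have := bs' k; rewrite lk => /andP[? ?]; apply/eqP;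
    rewrite eq_le; apply/andP.
have lhR : (lo k z)%:~R < (hi k z)%:~R :> R
  by rewrite ltr_int lt_neqAle lk low_le_high.
pose set_k (c : R) j := if j == k then c else s' j.
have Hk c : c = (lo k z)%:~R \/ c = (hi k z)%:~R ->
  convex_hull p (combo (set_k c)).
  move=> cE; apply: IH => [j|j]; rewrite /set_k; case: eqP => [->|jk].
  - by case: cE => ->; rewrite lexx ltW.
  - exact: bs'.
  - by right.
  - by have [|] := rs' j; [rewrite inE => /orP[/eqP //|]; left|right].
pose t := ((hi k z)%:~R - s' k) / ((hi k z)%:~R - (lo k z)%:~R).
have d0 : 0 < (hi k z)%:~R - (lo k z)%:~R :> R by rewrite subr_gt0.
have /andP[lk1 lk2] := bs' k.
have t01 : 0 <= t <= 1.
  by rewrite /t divr_ge0 ?subr_ge0 ?(ltW lhR) //= ler_pdivrMr // mul1r lerB.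
rewrite (_ : combo s' = t *: combo (set_k (lo k z)%:~R) + (1 - t) *: combo
  (set_k (hi k z)%:~R)).
  by apply: convex_hull_convex => //; apply: Hk; [left|right].
rewrite -!comboZ -comboD; congr combo; apply/funext => j; rewrite /set_k.
case: eqP => [->|_]; last by ring.
by rewrite /t; field; rewrite gt_eqF.
Qed.

(** The relative interior of a linear image of a box is the image of the
relative interior of the box. A relative interior point can be pushed away from
the image of the centre of the box, hence is a proper convex combination of it
with another point. Conversely, a small displacement in the affine hull is
realized by a small change of the coefficients in the nondegenerate intervals,
through a partial inverse of the matrix of their generators. *)
Lemma relative_interior_tile z : relative_interior (tile z) = open_tile z.
Proof.
apply/seteqP; split=> [y [[s bs sy] nY]|_ [s [bs os] <-]].
  pose mid j : R := ((lo j z)%:~R + (hi j z)%:~R) / 2.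
  have [bm om] : open_box a beta z mid := open_box_mid a beta z.
  pose y' (e : R) := y + e *: (y - combo mid).
  have cy : y' e @[e --> 0^'+] --> y.
    apply: cvg_at_right_filter; rewrite -[X in _ --> X]addr0.
    apply: cvgD; first exact: cvg_cst.
    rewrite -[X in _ --> X](scale0r (y - combo mid)).
    by apply: (@cvgZr_tmp _ _ R (nbhs (0 : R)) _ id); exact: cvg_id.
  have [e e0 te] : exists2 e, 0 < e & tile z (y' e).
    have N : \forall e \near (0 : R)^'+, affine_hull (tile z) (y' e) ->
      tile z (y' e).
      exact: cy nY.
    near (0 : R)^'+ => e; exists e; first by near: e; exact: nbhs_right_gt.
    suff : affine_hull (tile z) (y' e) by near: e.
    exists 2, (fun i : 'I_2 => if i == ord0 then y else combo mid),
      (fun i : 'I_2 => if i == ord0 then 1 + e else - e); split.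
    - by move=> i; case: ifP => _; [exists s|exists mid].
    - by rewrite !big_ord_recl big_ord0 /=; ring.
    - rewrite !big_ord_recl big_ord0 /= /y' addr0 scalerBr scalerDl scale1r.
      by rewrite scaleNr addrA.
  have [s1 bs1 sE] := te.
  have e1 : 0 < 1 + e by rewrite addr_gt0.
  exists (fun j => (1 + e)^-1 * (s1 j + e * mid j)); last first.
    rewrite comboZ comboD comboZ sE /y' scalerBr addrA subrK -{1}[y]scale1r.
    by rewrite -scalerDl scalerA mulVf ?scale1r // gt_eqF.
  split=> j; have /andP[l1 l2] := bs1 j.
    have /andP[m1 m2] := bm j.
    rewrite ler_pdivlMl // ler_pdivrMl //.
    by apply/andP; split; rewrite mulrDl mul1r lerD // ler_wpM2l // ltW.
  move=> /om/andP[m1 m2]; rewrite ltr_pdivlMl // ltr_pdivrMl //.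
  by apply/andP; split; rewrite mulrDl mul1r ler_ltD // ltr_pM2l.
split; first by exists s.
pose free j := lo j z < hi j z.
pose M : 'M[R]_(#|J|, m) :=
  \matrix_i (if free (enum_val i) then gen (enum_val i) else 0).
have ME (w : 'rV[R]_#|J|) :
    w *m M = combo (fun j => if free j then w 0 (enum_rank j) else 0).
  rewrite mulmx_sum_row /combo [RHS](reindex_onto enum_val enum_rank) /=;
    last first.
    by move=> j _; rewrite enum_rankK.
  apply: eq_big => [i|i _]; first by rewrite enum_valK eqxx.
  by rewrite rowK enum_valK; case: ifP; rewrite ?scaler0 ?scale0r.
pose c (w : V) j : R := if free j then (w *m pinvmx M) 0 (enum_rank j) else 0.
have cE (r : J -> R) : (forall j, ~~ free j -> r j = 0) ->
  combo (c (combo r)) = combo r.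
  move=> r0; rewrite -ME mulmxKpV //.
  rewrite (_ : combo r = (\row_i r (enum_val i)) *m M) ?submxMl //.
  rewrite ME; congr combo; apply/funext => j; rewrite mxE enum_rankK.
  by case: ifPn => // /r0.
have cc : \forall y' \near combo s, forall j,
    free j -> (lo j z)%:~R < s j + c (y' - combo s) j < (hi j z)%:~R.
  suff H j : \forall y' \near combo s,
      free j -> (lo j z)%:~R < s j + c (y' - combo s) j < (hi j z)%:~R.
    exact: (filter_forall (nbhs_filter (combo s)) H).
  have [fj|fj] := boolP (free j); last first.
    by apply: (@filterE V (nbhs (combo s)) (nbhs_filter _)).
  rewrite /c fj.
  have /andP[l1 l2] := os j fj.
  pose f (y' : V) := s j + ((y' - combo s) *m pinvmx M) 0 (enum_rank j).
  have fE y' : f y' = s j + dot (row (enum_rank j) (pinvmx M)^T) (y' - combo s).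
    by rewrite /f mxE; congr (_ + _); apply: eq_bigr => k _; rewrite !mxE mulrC.
  have cf : f y' @[y' --> combo s] --> f (combo s).
    have -> : f = fun y' =>
      s j + dot (row (enum_rank j) (pinvmx M)^T) (y' - combo s).
      exact/funext.
    apply: (@cvgD R R V (nbhs (combo s)) _ (fun=> s j)); first exact: cvg_cst.
    apply: (@continuous_comp _ _ _ (fun y' => y' - combo s));
      last exact: dot_continuous.
    by apply: (@cvgB R V V (nbhs (combo s)) _ id (cst _));
      [exact: cvg_id|exact: cvg_cst].
  have fs : f (combo s) = s j by rewrite /f subrr mul0mx mxE addr0.
  rewrite fs in cf.
  have F1 := @cvgr_gt _ _ _ (nbhs_filter (combo s)) f (s j) cf _ l1.
  have F2 := @cvgr_lt _ _ _ (nbhs_filter (combo s)) f (s j) cf _ l2.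
  apply: (@filterS2 _ _ (nbhs_filter (combo s)) _ _ _ _ F1 F2) => y' e1 e2 _.
  by apply/andP; split.
apply: filterS cc => y' cy' [k [p [w [tp w1 yE]]]].
have /choice[q qP] i : exists q, box z q /\ combo q = p i by have [q] := tp i;
  exists q.
pose r j := \sum_i w i * q i j.
have rE : combo r = y'.
  rewrite (combo_sum _ _ (fun i j => w i * q i j)) yE; apply: eq_bigr => i _.
  by rewrite comboZ (qP i).2.
have deg t j : box z t -> ~~ free j -> t j = (lo j z)%:~R.
  move=> /(_ j)/andP[t1 t2]; rewrite -leNgt => hl.
  by apply/eqP; rewrite eq_le t1 (le_trans t2) ?ler_int.
have rs j : ~~ free j -> r j - s j = 0.
  move=> fj; rewrite (deg s) // /r.
  rewrite (eq_bigr (fun i => w i * (lo j z)%:~R)) => [|i _].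
    by rewrite -mulr_suml w1 mul1r subrr.
  by rewrite (deg (q i)) //; exact: (qP i).1.
have yy : y' = combo (fun j => s j + c (y' - combo s) j).
  by rewrite comboD -rE -comboB cE // comboB addrC subrK.
exists (fun j => s j + c (y' - combo s) j) => // j.
have [fj|fj] := boolP (free j).
  by have /andP[l1 l2] := cy' j fj; rewrite !ltW.
by rewrite /c (negbTE fj) addr0; exact: bs.
Unshelve. all: by end_near. Qed.

Lemma tile_compact z : compact (tile z).
Proof.
pose I_ (i : 'I_#|J|) : set R :=
  [set` `[(lo (enum_val i) z)%:~R, (hi (enum_val i) z)%:~R]].
pose C := [set v : 'rV[R]_#|J| | forall i, I_ i (v ord0 i)].
have cC : compact C by apply: (@rV_compact R #|J| I_) => i;
  exact: segment_compact.
pose f (v : 'rV[R]_#|J|) : V := combo (fun j => v 0 (enum_rank j)).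
have -> : tile z = f @` C.
  apply/seteqP; split=> [_ [s bs <-]|_ [v Cv <-]].
    exists (\row_i s (enum_val i)).
      by move=> i; rewrite /I_ /= mxE in_itv /=; exact: bs.
    by congr combo; apply/funext => j; rewrite mxE enum_rankK.
  exists (fun j => v 0 (enum_rank j)) => // j.
  by have := Cv (enum_rank j); rewrite /I_ /= in_itv /= enum_rankK.
apply: continuous_compact => //; apply: continuous_subspaceT => v.
have -> : f = \sum_j (fun v : 'rV[R]_#|J| => v 0 (enum_rank j) *: gen j).
  by apply/funext => w; rewrite fct_sumE.
elim/big_ind: _ => [|g h cg ch|j _]; first exact: cst_continuous.
  exact: (@cvgD R V _ (nbhs v) _ g h).
by apply: (@cvgZr_tmp R V _ (nbhs v)); exact: coord_continuous.
Qed.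

Definition idot (p v : 'rV[int]_m) : int := \sum_k p 0 k * v 0 k.

(** The translation of the tiles induced by the translation v. *)
Definition period_int (v : 'rV[int]_m) : 'rV[int]_m :=
  \sum_j idot (a j) v *: a j.

Definition period (v : 'rV[int]_m) : V := map_mx intr (period_int v).

Lemma idotD (p v w : 'rV[int]_m) : idot p (v + w) = idot p v + idot p w.
Proof. by rewrite -big_split; apply: eq_bigr => k _; rewrite !mxE mulrDr. Qed.

Lemma periodD v w : period (v + w) = period v + period w.
Proof.
rewrite /period -map_mxD; congr map_mx; rewrite /period_int -big_split.
by apply: eq_bigr => j _; rewrite idotD scalerDl.
Qed.

Lemma period0 : period 0 = 0.
Proof. by apply: (addIr (period 0)); rewrite -periodD !add0r. Qed.

Lemma periodN v : period (- v) = - period v.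
Proof. by apply: (addIr (period v)); rewrite -periodD !addNr period0. Qed.

Lemma dot_gen_int j (v : 'rV[int]_m) : dot (gen j) (map_mx intr v) =
  (idot (a j) v)%:~R.
Proof.
by rewrite rmorph_sum; apply: eq_bigr => k _; rewrite !mxE rmorphM.
Qed.

Lemma periodE v : period v = combo (fun j => (idot (a j) v)%:~R).
Proof.
apply/rowP => k; rewrite !mxE !summxE rmorph_sum; apply: eq_bigr => j _.
by rewrite !mxE rmorphM.
Qed.

Lemma height_translate j z (v : 'rV[int]_m) :
  height a beta j (z + map_mx intr v) = height a beta j z + (idot (a j) v)%:~R.
Proof. by rewrite /height linearD /= dot_gen_int; ring. Qed.

Lemma low_translate j z v : lo j (z + map_mx intr v) = lo j z + idot (a j) v.
Proof. by rewrite /low height_translate ceilDrz ?intrKceil ?intr_int. Qed.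

Lemma high_translate j z v : hi j (z + map_mx intr v) = hi j z + idot (a j) v.
Proof. by rewrite /high height_translate floorDrz ?intrKfloor ?intr_int //
  addrAC. Qed.

Lemma low_translateR j z v :
  (lo j (z + map_mx intr v))%:~R = (lo j z)%:~R + (idot (a j) v)%:~R :> R.
Proof. by rewrite low_translate intrD. Qed.

Lemma high_translateR j z v :
  (hi j (z + map_mx intr v))%:~R = (hi j z)%:~R + (idot (a j) v)%:~R :> R.
Proof. by rewrite high_translate intrD. Qed.

Lemma cell_le_translate v z z' : cell_le a beta z z' ->
  cell_le a beta (z + map_mx intr v) (z' + map_mx intr v).
Proof. by move=> zz' j;
  rewrite !low_translate !high_translate !(lerD2r (idot (a j) v)); exact: zz'.
  Qed.

Lemma open_tile_translate v z y : open_tile z y ->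
  open_tile (z + map_mx intr v) (y + period v).
Proof.
move=> [s [bs os] <-]; exists (fun j => s j + (idot (a j) v)%:~R); last first.
  by rewrite comboD periodE.
split=> j; rewrite low_translateR high_translateR; first by rewrite !lerD2r;
  exact: bs.
by rewrite low_translate high_translate (ltrD2r (idot (a j) v)) => /os;
  rewrite !ltrD2r.
Qed.

Lemma tile_translate v z y : tile z y ->
  tile (z + map_mx intr v) (y + period v).
Proof.
move=> [s bs <-]; exists (fun j => s j + (idot (a j) v)%:~R).
  by move=> j; rewrite low_translateR high_translateR !lerD2r; exact: bs.
by rewrite comboD periodE.
Qed.

Lemma tile_translateP v z y : tile (z + map_mx intr v) y <->
  tile z (y - period v).
Proof.
split=> [/(tile_translate (- v))|/(tile_translate v)]; last by rewrite subrK.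
by rewrite map_mxN addrK periodN.
Qed.

End TileGeometry.

(** * Topology of subtypes and of integer-valued functions *)

Section SetType.
Variable (X : topologicalType) (A : set X).

Lemma nbhs_set_type (x : A) (U : set A) : nbhs x U ->
  exists2 W : set X, nbhs (\val x) W & \val @^-1` W `<=` U.
Proof.
move=> [_ [/= [W oW <-] Wx WU]]; exists W => //.
exact: open_nbhs_nbhs.
Qed.

Lemma within_continuous_set_type (Y : topologicalType) (D : set Y) (f : Y -> A)
    (g : Y -> X) :
  (forall y, D y -> \val (f y) = g y) -> {within D, continuous g} ->
  {within D, continuous f}.
Proof.
move=> fg cg; apply/subspace_continuousP => y Dy U /nbhs_set_type[W nW WU].
have {}nW : nbhs (g y) W by rewrite -fg.
have cgW : nbhs y [set y' | D y' -> W (g y')] :=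
  (subspace_continuousP _ _).1 cg y Dy W nW.
suff : nbhs y [set y' | D y' -> U (f y')] by [].
by apply: (filterS _ cgW) => y' /= + Dy' => /(_ Dy') Wy'; apply: WU;
  rewrite /preimage /= fg.
Qed.

Lemma set_type_compact : compact A -> compact [set: A].
Proof.
move=> cA F FF _; pose G : set_system X := \val @ F.
have GA : G A.
  suff E : (\val : A -> X) @^-1` A = setT by rewrite /G /= /fmap /= E;
    exact: filterT.
  by apply/seteqP; split=> // y _; exact: set_valP.
have [x [Ax clx]] := cA G _ GA.
exists (exist _ x (mem_set Ax)); split=> // B C FB /nbhs_set_type[W nW WC].
have GB : G ((\val : A -> X) @` B).
  suff : F (\val @^-1` ((\val : A -> X) @` B)) by [].
  by apply: (filterS _ FB) => y By; exists y.
have [_ [[y By <-] Wy]] := clx _ _ GB nW.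
by exists y; split=> //; exact: WC.
Qed.

End SetType.

Lemma connected_integers_const (R : realType) (S : set R) :
  connected S -> (forall s, S s -> s \is a Num.int) ->
  forall s t, S s -> S t -> s = t.
Proof.
move=> /connected_intervalP iS Sint.
suff lt s t : S s -> S t -> ~ s < t.
  by move=> s t Ss St; have [/lt|/lt|//] := ltgtP s t; case.
move=> Ss St st.
have /intrP[p sE] := Sint _ Ss; have /intrP[q tE] := Sint _ St.
rewrite sE tE ltr_int in st.
have pq : p%:~R + 1 <= q%:~R :> R by rewrite -[1]/(1%:~R) -intrD ler_int; lia.
have /Sint/intrP[r rE] : S (s + 2^-1).
  apply: (iS s t) => //; rewrite sE tE; apply/andP; split; lra.
have : 2 * (r - p)%:~R = 1 :> R by rewrite intrB -rE sE; field.
by rewrite -[2]/(2%:~R) -intrM => /eqP; rewrite -[1]/(1%:~R) eqr_int; lia.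
Qed.

(** * The space of classes of points modulo periods *)

Section QuotientSpace.
Variables (R : realType) (m : nat) (J : finType).
Variables (a : J -> 'rV[int]_m) (beta : J -> R) (I : Type) (z_ : I -> 'rV[R]_m).
Local Notation V := 'rV[R]_m.
Local Notation tile := (tile a beta).
Local Notation period := (@period R m J a).

Definition period_class (y : V) : set V := range (fun v => y + period v).

Lemma period_classP (x y : V) :
  period_class x = period_class y <-> exists v, y = x + period v.
Proof.
split=> [E|[v ->]].
  have : period_class y y by exists 0; rewrite ?period0 ?addr0.
  by rewrite -E => -[v _ <-]; exists v.
apply/seteqP; split=> _ [w _ <-].
  by exists (w - v) => //;
    rewrite periodD periodN [X in _ + X]addrC addrA addrK.
by exists (v + w) => //; rewrite periodD addrA.
Qed.

Definition tile_space : Type :=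
  {O : set V | exists i y, tile (z_ i) y /\ O = period_class y}.

Definition tile_cell i : polytope R := Polytope (tile_polytope a beta (z_ i)).

Lemma tile_cellP i (x : tile_cell i) : tile (z_ i) (\val x).
Proof. exact: set_valP. Qed.

Definition tile_map i (x : tile_cell i) : tile_space :=
  exist _ (period_class (\val x))
    (ex_intro _ i (ex_intro _ (\val x) (conj (tile_cellP x) erefl))).

HB.instance Definition _ := gen_eqMixin tile_space.
HB.instance Definition _ := gen_choiceMixin tile_space.

(** The final topology of the tile maps makes closedness a condition on the
cells; it is at least as fine as the quotient of the topology of R^m, where
distinct classes have disjoint neighbourhoods. *)
Definition final_open (U : set tile_space) := forall i,
  open (@tile_map i @^-1` U).

Lemma final_openT : final_open setT.
Proof. by move=> i; rewrite preimage_setT; exact: openT. Qed.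

Lemma final_openI : setI_closed final_open.
Proof. by move=> U W oU oW i; rewrite preimage_setI; exact: openI. Qed.

Lemma final_open_bigcup (K : Type) (f : K -> set tile_space) :
  (forall k, final_open (f k)) -> final_open (\bigcup_k f k).
Proof. by move=> oU_ i; rewrite preimage_bigcup; apply: bigcup_open => k _;
  exact: oU_. Qed.

HB.instance Definition _ := isOpenTopological.Build tile_space
  final_openT final_openI final_open_bigcup.

Lemma tile_space_openE (U : set tile_space) : open U = final_open U.
Proof. by []. Qed.

Lemma tile_map_eq i k (x : tile_cell i) (y : tile_cell k) :
  tile_map x = tile_map y <-> exists v, \val y = \val x + period v.
Proof.
rewrite -period_classP; split=> [/(congr1 sval) //|E].
exact: eq_exist.
Qed.

Lemma tile_map_continuous i : continuous (@tile_map i).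
Proof. by apply/continuousP => U oU; exact: oU. Qed.

Lemma tile_space_ind (P : tile_space -> Prop) :
  (forall i x, P (@tile_map i x)) -> forall p, P p.
Proof.
move=> H [p [i [y [ty E]]]].
have := H i (exist _ y (mem_set ty)).
congr P; exact: eq_exist.
Qed.

(** Periods are integer vectors, so a point that is not a period keeps a
positive distance from all of them. *)
Lemma period_discrete (y : V) : (forall v, y <> period v) ->
  exists2 e : R, 0 < e & forall v, exists k, e <= `|y 0 k - period v 0 k|.
Proof.
move=> yp; have [yint|] := pselect (forall k, y 0 k \is a Num.int).
  exists 1 => // v; apply: contrapT => /forallNP H; apply: (yp v).
  apply/rowP => k; have /negP := H k; rewrite -ltNge => lt1.
  have : y 0 k - period v 0 k \is a Num.int by rewrite rpredB // mxE intr_int.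
  move=> /intrP[q qE]; move: lt1; rewrite qE -intr_norm -[1]/(1%:~R) ltr_int =>
    q1.
  have q0 : q = 0 by lia.
  by apply/eqP; rewrite -subr_eq0 qE q0.
move=> /existsNP[k yk]; set f := Num.floor (y 0 k).
have f1 : f%:~R < y 0 k.
  rewrite lt_neqAle floor_le andbT; apply/negP => /eqP E.
  by apply: yk; rewrite -E intr_int.
have f2 : y 0 k < (f + 1)%:~R by exact: floorD1_gt.
exists (Num.min (y 0 k - f%:~R) ((f + 1)%:~R - y 0 k)).
  by rewrite lt_min !subr_gt0 f1.
move=> v; exists k; rewrite [period v 0 k]mxE; set p := period_int _ _ _ _.
rewrite ge_min; have [pf|fp] := leP p f.
  have pf' : p%:~R <= f%:~R :> R by rewrite ler_int.
  by rewrite ger0_norm ?subr_ge0; lra.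
have pf' : (f + 1)%:~R <= p%:~R :> R by rewrite ler_int; lia.
by rewrite ler0_norm ?subr_le0; lra.
Qed.

Lemma open_tube (c : V) (e : R) :
  open [set y : V | forall k, `|y 0 k - c 0 k| < e].
Proof.
suff H k : open [set y : V | `|y 0 k - c 0 k| < e].
  rewrite openE => y Hy; apply: (filter_forall (nbhs_filter y)) => k.
  by apply: open_nbhs_nbhs; split; [exact: H|exact: Hy].
have -> : [set y : V | `|y 0 k - c 0 k| < e] =
  (fun y : V => y 0 k) @^-1` (ball (c 0 k) e).
  by apply/seteqP; split=> y; rewrite /= /ball /= distrC.
have /continuousP : continuous (fun y : V => y 0 k) by move=> y;
  exact: coord_continuous.
by apply; exact: ball_open.
Qed.

(** Distinct classes are separated by the unions of the cubes around their
points whose size is half the distance given by [period_discrete]. *)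
Lemma tile_space_hausdorff : hausdorff_space tile_space.
Proof.
elim/tile_space_ind => i x; elim/tile_space_ind => k y cl.
apply: contrapT => xy; have [v|e e0 He] := @period_discrete (\val y - \val x).
  by move=> E; apply/xy/tile_map_eq; exists v; rewrite -E addrC subrK.
pose N (c : V) : set tile_space :=
  [set p : tile_space | exists2 w : V, sval p w & forall j,
    `|w 0 j - c 0 j| < e / 2].
have e2 : 0 < e / 2 by rewrite divr_gt0.
have oN c : open (N c).
  rewrite tile_space_openE => l.
  have -> : @tile_map l @^-1` N c = \bigcup_v (\val @^-1`
      [set w : V | forall j, `|w 0 j - (c - period v) 0 j| < e / 2]).
    apply/seteqP; split=> [w [_ [v _ <-] H]|w [v _ H]].
      exists v => // j; have := H j; rewrite !mxE.
      by congr (`|_| < _); ring.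
    exists (\val w + period v); first by exists v.
    by move=> j; have := H j; rewrite /= !mxE; congr (`|_| < _); ring.
  apply: bigcup_open => v _;
    exists [set w : V | forall j, `|w 0 j - (c - period v) 0 j| < e / 2] => //.
  exact: open_tube.
have Nx : nbhs (tile_map x) (N (\val x)).
  apply: open_nbhs_nbhs; split=> //; exists (\val x).
    by exists 0; rewrite ?period0 ?addr0.
  by move=> j; rewrite subrr normr0.
have Ny : nbhs (tile_map y) (N (\val y)).
  apply: open_nbhs_nbhs; split=> //; exists (\val y).
    by exists 0; rewrite ?period0 ?addr0.
  by move=> j; rewrite subrr normr0.
have [p [[w1 Ow1 H1] [w2 Ow2 H2]]] := cl _ _ Nx Ny.
have [v w2E] : exists v, w2 = w1 + period v.
  clear Nx Ny H1 H2; move: p Ow1 Ow2;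
    elim/tile_space_ind => l p /= [v _ <-] [v' _ <-].
  exists (v' - v); rewrite periodD periodN.
  by rewrite [period v' - _]addrC addrA addrK.
have [j] := He v; apply/negP; rewrite -ltNge.
have wE : w2 0 j = w1 0 j + period v 0 j by rewrite w2E mxE.
have dE : (\val y - \val x) 0 j = \val y 0 j - \val x 0 j
  by rewrite mxE [X in _ + X]mxE.
have := H1 j; have := H2 j; rewrite wE dE.
rewrite !ltr_norml => /andP[? ?] /andP[? ?].
by apply/andP; split; lra.
Qed.

End QuotientSpace.

(** * The dual polyhedral complex and its face maps *)

Section Complex.
Variables (R : realType) (m : nat) (J : finType).
Variables (a : J -> 'rV[int]_m) (beta : J -> R) (I : Type) (z_ : I -> 'rV[R]_m).
Local Notation V := 'rV[R]_m.
Local Notation tile := (tile a beta).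
Local Notation open_tile := (open_tile a beta).
Local Notation cell_le := (cell_le a beta).
Local Notation period := (@period R m J a).
Local Notation tile_space := (tile_space a beta z_).
Local Notation tile_cell := (tile_cell a beta z_).
Local Notation tile_map := (@tile_map R m J a beta I z_).
Local Notation shift v := (map_mx intr v : V).

Lemma cell_le_open_tile z z' : cell_le z z' -> cell_le z' z ->
  open_tile z = open_tile z'.
Proof.
move=> zz' z'z; have E j : low a beta j z = low a beta j z' /\
  high a beta j z = high a beta j z'.
  have [l1 h1] := zz' j; have [l2 h2] := z'z j.
  by split; apply/eqP; rewrite eq_le ?l1 ?l2 ?h1 ?h2.
suff eqb : open_box a beta z = open_box a beta z' by congr (_ @` _).
apply/funext => s; apply/propext; split=> -[bs os]; split=> j.
- by have [<- <-] := E j; exact: bs.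
- by have [<- <-] := E j; exact: os.
- by have [-> ->] := E j; exact: bs.
- by have [-> ->] := E j; exact: os.
Qed.

(** The boxes of z and z + v have the same side lengths, so an inclusion between
them is an equality. *)
Lemma cell_le_shift_self z v : cell_le z (z + shift v) ->
  cell_le (z + shift v) z /\ period v = 0.
Proof.
move=> H; have E j : idot (a j) v = 0.
  by have [] := H j; rewrite low_translate high_translate; lia.
split=> [j|].
  by rewrite low_translate high_translate E !addr0.
rewrite /period /period_int big1 ?map_mx0 // => j _.
by rewrite E scale0r.
Qed.

Lemma polytope_interior_tile i (x : tile_cell i) :
  polytope_interior (tile_cell i) x <-> open_tile (z_ i) (\val x).
Proof. by rewrite -relative_interior_tile. Qed.

Lemma tile_map_inj_interior i (x x' : tile_cell i) :
  polytope_interior (tile_cell i) x -> tile_map x = tile_map x' -> x = x'.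
Proof.
move=> /polytope_interior_tile ox /tile_map_eq[v xE].
have := open_tile_translate v ox; rewrite -xE => ox'.
have [_ v0] := cell_le_shift_self (open_tile_le ox' (tile_cellP x')).
by apply: val_inj; rewrite xE v0 addr0.
Qed.

Lemma tile_map_closed i (C : set (tile_cell i)) : closed C ->
  closed (@tile_map i @` C).
Proof.
move=> cC; apply: compact_closed; first exact: tile_space_hausdorff.
apply: continuous_compact; first exact/continuous_subspaceT/tile_map_continuous.
apply: (@subclosed_compact _ _ setT cC) => //.
exact: (@set_type_compact V (tile (z_ i)) (@tile_compact R m J a beta (z_ i))).
Qed.

Definition tile_point k y (ty : tile (z_ k) y) : tile_cell k :=
  exist _ y (mem_set ty).

Definition tile_center i : tile_cell i.
Proof. by apply: cid; have [y ty] := tile_neq0 a beta (z_ i); exists y;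
  exact: mem_set. Defined.

(** The inverse on the open cell is continuous because the tile map is closed,
by compactness of tiles, and injective against the whole tile on interior
points. *)
Lemma tile_PC0 i :
  homeo_onto_image (polytope_interior (tile_cell i)) (@tile_map i).
Proof.
split; first exact/continuous_subspaceT/tile_map_continuous.
pose int := polytope_interior (tile_cell i).
pose g p := xget (tile_center i) [set x | int x /\ tile_map x = p].
have gK x : int x -> g (tile_map x) = x.
  move=> ix; rewrite /g;
    case: xgetP => [y _ [iy] /(tile_map_inj_interior iy) //|].
  by move=> /(_ x) [].
exists g => [x|]; first by rewrite inE => /gK.
apply/subspace_continuousP => _ [x ix <-] U; rewrite /from_subspace /= gK // =>
  nU.
have [W [oW Wx] WU] : exists2 W, open_nbhs x W & W `<=` U by move: nU;
  rewrite nbhsE.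
have cW : closed (tile_map (i:=i) @` (~` W))
  by apply/tile_map_closed/open_closedC.
have nN : nbhs (tile_map x) (~` (tile_map (i:=i) @` (~` W))).
  apply: open_nbhs_nbhs; split; first exact: closed_openC.
  by move=> [y Wy E]; apply: Wy; rewrite -(tile_map_inj_interior ix (esym E)).
suff : nbhs (tile_map x) [set p | (tile_map (i:=i) @` int) p -> U (g p)] by [].
apply: (filterS _ nN) => p /= np [y iy yp]; rewrite -yp gK //; apply: WU.
by apply: contrapT => Wy; apply: np; exists y.
Qed.

Lemma tile_PC2 (B : set tile_space) :
  closed B <-> forall i, closed (B `&` range (@tile_map i)).
Proof.
split=> [cB i|H].
  by apply: closedI => //; apply: tile_map_closed; exact: closedT.
rewrite -openC tile_space_openE => i.
suff -> : @tile_map i @^-1` (~` B) =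
  ~` (@tile_map i @^-1` (B `&` range (@tile_map i))).
  by apply: closed_openC; apply: (continuous_closedP _).1 (H i);
    exact: tile_map_continuous.
by apply/seteqP; split=> [x nB [] //|x nB Bx]; apply: nB; split=> //; exists x.
Qed.

Definition translation k i v (H : cell_le (z_ i) (z_ k + shift v))
    (x : tile_cell k) : tile_cell i :=
  tile_point (cell_le_tile H (tile_translate v (tile_cellP x))).

Lemma translation_polyhedral k i v (H : cell_le (z_ i) (z_ k + shift v)) :
  @polyhedral_homeo R (tile_cell k) (tile_cell i) (tile (z_ k + shift v))
    (translation H).
Proof.
have cadd (w : V) : continuous (fun x : V => x + w).
  by move=> x; apply: (@cvgD R V V (nbhs x) _ id (cst w));
    [exact: cvg_id|exact: cvg_cst].
have caddval l w : continuous (fun x : tile_cell l => \val x + w).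
  move=> x; apply: (@continuous_comp _ _ _ (\val : tile_cell l -> V)
    (fun x : V => x + w)).
    exact: (@initial_continuous (tile_cell l) V \val).
  exact: cadd.
split.
- split.
    apply: (@within_continuous_set_type V (tile_cell i) (tile_cell k) setT
      (translation H)
      (fun x => \val x + period v)) => //.
    exact/continuous_subspaceT/caddval.
  pose g (y : tile_cell i) : tile_cell k :=
    insubd (tile_center k) (\val y - period v).
  exists g.
    by move=> x _; apply: val_inj; rewrite /g /= addrK valKd.
  apply: (@within_continuous_set_type V (tile_cell k) (tile_cell i) _ g
    (fun y => \val y - period v)).
    by move=> _ [x _ <-]; rewrite /g /= addrK valKd.
  exact/continuous_subspaceT/caddval.
- apply/seteqP; split=> [_ [x _ <-]|y ty].
    exact/tile_translate/tile_cellP.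
  have ty' := (tile_translateP _ _ _ _ _).1 ty.
  by exists (tile_point ty') => //=; rewrite subrK.
- move=> E /(face_tileP _ _ _ _).1 [z' zz' ->]; apply/face_tileP.
  exists (z' + shift v); first exact: cell_le_translate.
  apply/seteqP; split=> [_ [x tx <-]|y ty]; first exact: tile_translate.
  have ty' := (tile_translateP _ _ _ _ _).1 ty.
  exists (tile_point (cell_le_tile zz' ty')) => //=.
  by rewrite subrK.
Qed.

(** The points z_ i represent, up to integer translations, the members of an
upward closed family of faces, each exactly once and with trivial
stabilizer. *)
Hypothesis z_up : forall i z', cell_le (z_ i) z' ->
  exists k v, cell_le z' (z_ k + shift v) /\ cell_le (z_ k + shift v) z'.
Hypothesis z_sep : forall i k v, cell_le (z_ i) (z_ k + shift v) ->
  cell_le (z_ k + shift v) (z_ i) -> i = k /\ v = 0.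

Lemma tile_PC1 :
  \bigcup_i open_cell (@tile_map i) = [set: tile_space] /\
  trivIset [set: I] (fun i => open_cell (@tile_map i)).
Proof.
split.
  rewrite -subTset => p _; elim/tile_space_ind: p => i x.
  have [z' zz' oz'] := tile_cover (tile_cellP x).
  have [k [v [l1 l2]]] := z_up zz'.
  rewrite (cell_le_open_tile l1 l2) in oz'.
  have := open_tile_translate (- v) oz'; rewrite map_mxN addrK => ox.
  exists k => //; exists (tile_point (open_tile_sub ox)).
    exact/polytope_interior_tile.
  by apply/tile_map_eq; exists v; rewrite /= periodN subrK.
move=> i k _ _ [_ [[x /polytope_interior_tile ox <-]]].
move=> [y /polytope_interior_tile oy].
move=> /tile_map_eq[v xE].
have := open_tile_translate v oy; rewrite -xE => oy'.
have l1 := open_tile_le ox (open_tile_sub oy').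
have l2 := open_tile_le oy' (open_tile_sub ox).
by have [] := z_sep l2 l1.
Qed.

Lemma translation_map k i v (H : cell_le (z_ i) (z_ k + shift v)) x :
  tile_map x = tile_map (translation H x).
Proof. by apply/tile_map_eq; exists v. Qed.

Lemma tile_PC3 i (F : set V) : is_face (tile_cell i) F ->
  exists k (phi : tile_cell k -> tile_cell i),
    @polyhedral_homeo R (tile_cell k) (tile_cell i) F phi /\
    forall x, tile_map x = tile_map (phi x).
Proof.
move=> /(face_tileP _ _ _ _).1 [z' zz' ->].
have [k [v [l1 l2]]] := z_up zz'.
exists k, (translation (cell_le_trans zz' l1)); split;
  last exact: translation_map.
suff -> : tile z' = tile (z_ k + shift v) by exact: translation_polyhedral.
by apply/seteqP; split; exact: cell_le_tile.
Qed.

Definition tile_complex : polyhedral_complex R :=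
  @PolyhedralComplex R tile_space I tile_cell (@tile_map)
    (@tile_space_hausdorff R m J a beta I z_)
    (@tile_map_continuous R m J a beta I z_)
    tile_PC0 tile_PC1 tile_PC2 tile_PC3.

(** A tile determines the face of its index, and integer translations act freely
on the faces represented by the z_ i. *)
Lemma period_inj (k : I) (v w : 'rV[int]_m) : period v = period w -> v = w.
Proof.
move=> vw; apply/eqP; rewrite -subr_eq0; apply/eqP.
have t y : tile (z_ k + shift (v - w)) y <-> tile (z_ k) y.
  by rewrite tile_translateP periodD periodN vw subrr subr0.
have l1 : cell_le (z_ k) (z_ k + shift (v - w)) by apply: tile_sub_le => y /t.
have l2 : cell_le (z_ k + shift (v - w)) (z_ k) by apply: tile_sub_le => y /t.
by have [] := z_sep l1 l2.
Qed.

Lemma translation_eq (k i : I) v w (H : cell_le (z_ i) (z_ k + shift v))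
    (H' : cell_le (z_ i) (z_ k + shift w)) :
  translation H = translation H' <-> v = w.
Proof.
split=> [E|vw]; last first.
  by apply/funext => x; apply: val_inj; rewrite /= vw.
apply: (period_inj k).
by have /(congr1 (fun f => \val (f (tile_center k))))/addrI := E.
Qed.

Lemma face_translation k i v (H : cell_le (z_ i) (z_ k + shift v)) :
  @is_face_map R tile_complex k i (translation H).
Proof.
split; last exact: translation_map.
exists (tile (z_ k + shift v)); last exact: translation_polyhedral.
by apply/face_tileP; exists (z_ k + shift v).
Qed.

(** The displacement of a point by a face map is a period, hence an integer
vector; it depends continuously on the point, so it is constant along segments.
*)
Lemma face_mapP k i (phi : tile_cell k -> tile_cell i) :
  @is_face_map R tile_complex k i phi ->
  exists v (H : cell_le (z_ i) (z_ k + shift v)), phi = translation H.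
Proof.
move=> [[F /(face_tileP _ _ _ _).1 [z' zz' FE] [[cphi _] imF _]] mphi].
have {mphi} vphi x : exists v, \val (phi x) = \val x + period v.
  by apply/tile_map_eq; exact: mphi.
have {}cphi : continuous phi by apply/continuous_subspace_setT.
have shift_const (x0 x : tile_cell k) :
  \val (phi x) - \val x = \val (phi x0) - \val x0.
  pose c (t : R) : V := t *: \val x + (1 - t) *: \val x0.
  have cc : continuous c.
    move=> t; apply: (@cvgD R V R (nbhs t)).
      by apply: (@cvgZr_tmp R V R (nbhs t)); exact: cvg_id.
    apply: (@cvgZr_tmp R V R (nbhs t)).
    by apply: (@cvgB R R R (nbhs t)); [exact: cvg_cst|exact: cvg_id].
  have tc t : 0 <= t <= 1 -> tile (z_ k) (c t).
    move=> t01; have [l [p E]] := tile_polytope a beta (z_ k).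
    have := tile_cellP x; have := tile_cellP x0; rewrite E => h0 h1.
    exact: convex_hull_convex.
  pose g t : tile_cell k := insubd x0 (c t).
  have gE t : 0 <= t <= 1 -> \val (g t) = c t.
    by move=> /tc tct; rewrite /g insubdK //; exact: mem_set.
  have cg : {within [set` `[0, 1]], continuous g}.
    apply: (@within_continuous_set_type V (tile_cell k) R _ g c) => [t|].
      by rewrite /= in_itv /= => /gE.
    exact: continuous_subspaceT.
  apply/rowP => j; pose d y : R := (\val (phi y) - \val y) 0 j.
  have cval l : continuous (\val : tile_cell l -> V).
    exact: (@initial_continuous (tile_cell l) V \val).
  have cd : continuous d.
    move=> y; apply: (@continuous_comp _ _ _ (fun y : tile_cell k =>
      \val (phi y) - \val y) (fun w : V => w 0 j)).
      apply: (@cvgB R V _ (nbhs y)); last exact: cval.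
      by apply: (@continuous_comp _ _ _ phi (\val : tile_cell i -> V));
        [exact: cphi|exact: cval].
    exact: coord_continuous.
  have d1 : d (g 1) = d x.
    congr d; apply: val_inj; rewrite gE /c ?lexx ?ler01 //.
    by rewrite scale1r subrr scale0r addr0.
  have d0 : d (g 0) = d x0.
    congr d; apply: val_inj; rewrite gE /c ?lexx ?ler01 //.
    by rewrite scale0r subr0 scale1r add0r.
  rewrite -/(d x) -/(d x0) -d1 -d0.
  apply: (@connected_integers_const R ((d \o g) @` [set` `[0, 1]])).
  - apply: connected_continuous_connected; first exact: segment_connected.
    by apply: within_continuous_comp => // y _; exact: cd.
  - move=> _ [t _ <-] /=; have [v vE] := vphi (g t).
    by rewrite /d vE addrC addKr mxE intr_int.
  - by exists 1 => //=; rewrite in_itv /= ler01 lexx.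
  - by exists 0 => //=; rewrite in_itv /= ler01 lexx.
have [v vE] := vphi (tile_center k).
have phiE x : \val (phi x) = \val x + period v.
  have := shift_const (tile_center k) x; rewrite vE [X in _ = X]addrC addKr.
  by move=> <-; rewrite addrC subrK.
have H : cell_le (z_ i) (z_ k + shift v).
  apply: (cell_le_trans zz'); apply: tile_sub_le; rewrite -FE -imF => y ty.
  have ty' := (tile_translateP _ _ _ _ _).1 ty.
  exists (tile_point ty') => //.
  by rewrite phiE /= subrK.
by exists v, H; apply/funext => x; apply: val_inj; rewrite phiE.
Qed.

End Complex.

(** * Faces of the lifted arrangement and morphisms of toric cells *)

Lemma inj_surj_bijective (S T : Type) (f : S -> T) :
  injective f -> (forall y, exists x, f x = y) -> bijective f.
Proof.
move=> fI /choice[g gK]; exists g => // x.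
by apply: fI; rewrite gK.
Qed.

Lemma sgr_eq (R : realType) (u v : R) :
  (u <= 0) = (v <= 0) -> (0 <= u) = (0 <= v) -> Num.sg u = Num.sg v.
Proof.
by have [u0|u0|->] := ltgtP u 0; have [v0|v0|->] := ltgtP v 0 => //;
  rewrite ?(ltr0_sg u0) ?(ltr0_sg v0) ?(gtr0_sg u0) ?(gtr0_sg v0).
Qed.

Section Bridge.
Variables (R : realType) (d n : nat) (X : arrangement_data R d n).
Local Notation V := 'rV[R]_d.
Local Notation A := (ar_mx X).
Local Notation b := (ar_offset X).
Local Notation shift v := (map_mx intr v : 'rV[R]_ _).

Definition column (j : 'I_n) : 'rV[int]_d := \row_k A k j.
Definition offset (j : 'I_n) : R := repr (b j).
Local Notation cell_le := (cell_le column offset).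
Local Notation ht := (height column offset).
Local Notation lo := (low column offset).
Local Notation hi := (high column offset).

Lemma heightE j (x : V) : ht j x = column_form A j x - offset j.
Proof.
congr (_ - _); apply: eq_bigr => k _.
by rewrite !mxE mulrC mulrzr.
Qed.

Lemma pi_offset j (k : int) : circle_pi (offset j + k%:~R) = b j.
Proof.
rewrite -[RHS]reprK; apply/circle_pi_eq; exists k.
by rewrite /offset addrAC subrr add0r.
Qed.

Lemma pi_height j (x : V) :
  circle_pi (column_form A j x) = b j <-> ht j x \is a Num.int.
Proof.
rewrite heightE; split=> [|/intrP[k E]].
  rewrite -[b j](pi_offset j 0) => /circle_pi_eq[k]; rewrite addr0 => ->.
  exact: intr_int.
by rewrite -(pi_offset j k) -E addrC subrK.
Qed.

(** The hyperplanes {l = c} of [same_face] are given by arbitrary affine forms;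
a form vanishing on a level set of the j-th height is a multiple of the height
minus a constant, so all such forms compare signs in the same way. *)
Lemma same_faceP (x y : V) : same_face X x y <-> cell_le x y /\ cell_le y x.
Proof.
split=> [xy|[xy yx]].
  have side j (k : int) : Num.sg (ht j x - k%:~R) = Num.sg (ht j y - k%:~R).
    rewrite !heightE -!addrA -!opprD.
    apply: (xy (column_form A j : V -> R^o)); apply/lifted_arrangementP.
    by exists j, (offset j + k%:~R); rewrite pi_offset.
  have le0 j (k : int) : (ht j x <= k%:~R) = (ht j y <= k%:~R).
    by rewrite -subr_le0 -[in RHS]subr_le0 -sgr_le0 side sgr_le0.
  have ge0 j (k : int) : (k%:~R <= ht j x) = (k%:~R <= ht j y).
    by rewrite -subr_ge0 -[in RHS]subr_ge0 -sgr_ge0 side sgr_ge0.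
  have E j : lo j x = lo j y /\ hi j x = hi j y.
    rewrite /low /high; split.
      apply/eqP; rewrite eq_le !ceil_le_int le0 ceil_ge /= -le0.
      exact: ceil_ge.
    congr (_ + 1); apply/eqP; rewrite eq_le !floor_ge_int -ge0 floor_le /= ge0.
    exact: floor_le.
  by split=> j; have [-> ->] := E j.
move=> l c /lifted_arrangementP[j [t [tb LE]]].
have LE' z : (l z = c) = (column_form A j z = t).
  by have := congr1 (fun S => S z) LE.
have [k tE] : exists k : int, t = offset j + k%:~R.
  move: tb; rewrite -(pi_offset j 0) => /circle_pi_eq[k kE]; exists k.
  by rewrite -kE addr0 addrC subrK.
have [p pt] := column_form_surj X j t.
have [q qt] := column_form_surj X j (t + 1).
have lp : l p = c by rewrite LE'.
have lE z : l z - c = (column_form A j z - t) * (l q - c).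
  have : l (z - (column_form A j z - t) *: (q - p)) = c.
    rewrite LE' (linearB (column_form A j : V -> R^o)) linearZ.
    by rewrite (linearB (column_form A j : V -> R^o)) /=
      pt qt addrAC subrr add0r /GRing.scale /= mulr1 opprB addrC subrK.
  by rewrite linearB linearZ linearB /= lp => /eqP;
    rewrite subr_eq addrC -subr_eq => /eqP.
have tH z : column_form A j z - t = ht j z - k%:~R by rewrite heightE tE; ring.
rewrite (lE x) (lE y) !sgrM !tH; congr (_ * _).
have [l1 h1] := xy j; have [l2 h2] := yx j.
have loE : lo j x = lo j y by apply/eqP; rewrite eq_le l1.
have hiE : hi j x = hi j y by apply/eqP; rewrite eq_le h1 h2.
apply: sgr_eq; rewrite ?subr_le0 ?subr_ge0 -?ceil_le_int -?floor_ge_int.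
  by have := loE; rewrite /low => ->.
by have := hiE; rewrite /high => /addIr ->.
Qed.

Definition face (x : V) : set V := [set y | same_face X x y].

Lemma face_self x : face x x.
Proof. by []. Qed.

Lemma faces_face x : faces X (face x).
Proof. by exists x. Qed.

Lemma face_eqP x y : face x = face y <-> cell_le x y /\ cell_le y x.
Proof.
rewrite -same_faceP; split=> [E|xy].
  by have := face_self y; rewrite -E.
apply/seteqP; split=> z /= H l c L; first by rewrite -(xy l c L); exact: H.
by rewrite (xy l c L); exact: H.
Qed.

Lemma translate_face v x : translate v (face x) = face (x + shift v).
Proof.
rewrite translateE; apply/seteqP; split=> y /=.
  by move=> /(same_face_translate v); rewrite subrK.
by move=> /(same_face_translate (- v)); rewrite map_mxN addrK.
Qed.

Lemma column_height_continuous j : continuous (ht j : V -> R).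
Proof.
have -> : ht j = fun x => column_form A j x - offset j by apply/funext => x;
  exact: heightE.
move=> x; apply: (@cvgB R R V (nbhs x)); last exact: cvg_cst.
exact: column_form_continuous.
Qed.

(** From a point w of the smaller face, the segment towards y lies in the face
of y except for w. *)
Lemma face_closureP x y : face x `<=` closure (face y) <-> cell_le x y.
Proof.
split=> [/(_ x (face_self x)) cx j|xy w /same_faceP[xw wx]].
  have cH := @column_height_continuous j x.
  have mem w : face y w -> lo j w = lo j y /\ hi j w = hi j y.
    move=> /same_faceP[yw wy]; have [l1 h1] := yw j; have [l2 h2] := wy j.
    by split; apply/eqP; rewrite eq_le ?l1 ?l2 ?h1 ?h2.
  rewrite !leNgt; split; apply/negP => H.
    have : (lo j y)%:~R < ht j x by rewrite -ceil_gt_int.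
    move=> H'; have [w [/mem[wl _]]] := cx _ (cvgr_gt (ht j x) cH _ H').
    by rewrite /= -ceil_gt_int -/(lo j w) wl ltxx.
  have H' : ht j x < (hi j y - 1)%:~R.
    by rewrite -floor_lt_int ltrBrDr.
  have [w [/mem[_ wl]]] := cx _ (cvgr_lt (ht j x) cH _ H').
  by rewrite /= -floor_lt_int -wl /high addrK ltxx.
have wy := cell_le_trans wx xy.
move=> U nU; pose c (e : R) : V := w + e *: (y - w).
have cc : c e @[e --> 0^'+] --> w.
  apply: cvg_at_right_filter; rewrite -[X in _ --> X]addr0.
  apply: cvgD; first exact: cvg_cst.
  rewrite -[X in _ --> X](scale0r (y - w)).
  by apply: (@cvgZr_tmp _ _ R (nbhs (0 : R)) _ id); exact: cvg_id.
near (0 : R)^'+ => e.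
have e01 : 0 < e < 1.
  apply/andP; split; first by near: e; exact: nbhs_right_gt.
  by near: e; exact: nbhs_right_lt.
exists (c e); split; last by near: e; exact: cc nU.
have E j : lo j (c e) = lo j y /\ hi j (c e) = hi j y.
  have [l1] := wy j; rewrite /high lerD2r => h1.
  have hc : ht j (c e) = ht j w + e * (ht j y - ht j w).
    by rewrite /c /height !(linearD, linearZ, linearN) /=; ring.
  by rewrite /low /high hc; have [-> ->] := round_segment l1 h1 e01.
by apply/same_faceP; split=> j; have [-> ->] := E j.
Unshelve. all: by end_near. Qed.

Definition cell_of (x : V) : toric_cell X :=
  exist _ (face_orbit (face x)) (ex_intro2 _ _ _ (faces_face x) erefl).

Lemma cell_rep_exists (F : toric_cell X) : exists x,
  sval F = face_orbit (face x).
Proof. by have [P [x _ <-] ->] := svalP F; exists x. Qed.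

Definition cell_rep (F : toric_cell X) : V := sval (cid (cell_rep_exists F)).

Lemma cell_repE F : sval F = face_orbit (face (cell_rep F)).
Proof. exact: (svalP (cid (cell_rep_exists F))). Qed.

Lemma cell_face F P : sval F P <-> exists v, P = face (cell_rep F + shift v).
Proof.
rewrite cell_repE; split=> [[v _ <-]|[v ->]]; first by exists v;
  rewrite translate_face.
by exists v; rewrite ?translate_face.
Qed.

Lemma cell_of_rep x : exists v, cell_le x (cell_rep (cell_of x) + shift v) /\
  cell_le (cell_rep (cell_of x) + shift v) x.
Proof.
have /cell_face[v /face_eqP vE] : sval (cell_of x) (face x) by exists 0;
  rewrite ?translate0.
by exists v.
Qed.

Lemma cell_rep_sep F G v : cell_le (cell_rep F) (cell_rep G + shift v) ->
  cell_le (cell_rep G + shift v) (cell_rep F) -> F = G /\ v = 0.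
Proof.
move=> l1 l2; have E : face (cell_rep F) = translate v (face (cell_rep G)).
  by rewrite translate_face; exact/face_eqP.
have FG : F = G.
  have sinj (F' G' : toric_cell X) : sval F' = sval G' -> F' = G'.
    by case: F' G' => [f fP] [g gP] /= ?; exact: eq_exist.
  apply: sinj.
  rewrite !cell_repE E; apply/seteqP; split=> _ [w _ <-].
    by exists (w + v) => //; rewrite translateD.
  by exists (w - v) => //; rewrite translateD subrK.
split=> //; apply: (@translate_fix _ _ _ X v (face (cell_rep F)));
  first exact: faces_face.
by rewrite [RHS]E FG.
Qed.

(** If G lies in a hyperplane of the j-th family, its height is an integer k,
and the weak inequalities between heights and integers valid on G pass to the
smaller face F, whose height is k as well. *)
Lemma supportS F G v : cell_le (cell_rep F) (cell_rep G + shift v) ->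
  Defs.support G `<=` Defs.support F.
Proof.
move=> FG _ [[j _ <-] GH]; split; first by exists j.
have : toric_hyperplane X j (torus_pi (cell_rep G + shift v)).
  apply: GH; exists (face (cell_rep G + shift v));
    last by exists (cell_rep G + shift v).
  by apply/cell_face; exists v.
rewrite /toric_hyperplane /= column_form_pi => /pi_height/intrP[k kE].
have sq w : cell_le w (cell_rep G + shift v) -> ht j w = k%:~R.
  move=> /(_ j)[]; rewrite /low /high lerD2r kE intrKceil intrKfloor.
  by rewrite ceil_le_int floor_ge_int => *; apply/eqP; rewrite eq_le;
    apply/andP.
move=> _ [P /cell_face[u ->] [w wP <-]].
rewrite /toric_hyperplane /= column_form_pi; apply/pi_height.
have := wP; rewrite -translate_face translateE => /same_faceP[_ wF].
have := sq _ (cell_le_trans wF FG); rewrite -map_mxN height_translate => E.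
have -> : ht j w = k%:~R - (idot (column j) (- u))%:~R by rewrite -E addrK.
by rewrite rpredB ?intr_int.
Qed.

(** The orbit of pairs defining a morphism contains exactly one pair whose first
member is the representing face of F; the translation of its second member
encodes the morphism. *)
Lemma toric_hom_shift_exists (F G : toric_cell X) (m : toric_hom F G) :
  exists v, sval m (face (cell_rep F), face (cell_rep G + shift v)).
Proof.
have [P [Q [_ FP GQ _ ->]]] := svalP m.
move: FP GQ => /cell_face[u ->] /cell_face[w ->].
exists (w - u); exists (- u) => //; congr pair;
  rewrite translate_face map_mxN ?addrK //.
by rewrite -addrA -map_mxN -map_mxD.
Qed.

Definition hom_shift (F G : toric_cell X) (m : toric_hom F G) : 'rV[int]_d :=
  sval (cid (toric_hom_shift_exists m)).

Lemma hom_shiftE (F G : toric_cell X) (m : toric_hom F G) :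
  sval m (face (cell_rep F), face (cell_rep G + shift (hom_shift m))).
Proof. exact: (svalP (cid (toric_hom_shift_exists m))). Qed.

Lemma hom_pair_orbit (F G : toric_cell X) (m : toric_hom F G) P Q :
  sval m (P, Q) -> sval m = pair_orbit P Q.
Proof.
have [P0 [Q0 [_ _ _ _ ->]]] := svalP m => -[u _ [<- <-]].
apply/seteqP; split=> _ [w _ <-].
  by exists (w - u) => //; rewrite !translateD subrK.
by exists (w + u) => //; rewrite !translateD.
Qed.

Lemma hom_shift_uniq (F G : toric_cell X) (m : toric_hom F G) v :
  sval m (face (cell_rep F), face (cell_rep G + shift v)) -> hom_shift m = v.
Proof.
rewrite (hom_pair_orbit (hom_shiftE m)) => -[u _ []] uE.
have -> := translate_fix (faces_face _) uE.
rewrite translate0 -!translate_face.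
by apply: translate_inj; exact: faces_face.
Qed.

Lemma hom_shift_inj (F G : toric_cell X) : injective (@hom_shift F G).
Proof.
move=> m1 m2 E; have := hom_pair_orbit (hom_shiftE m1).
have := hom_pair_orbit (hom_shiftE m2); rewrite E.
by case: m1 m2 {E} => [m1 ?] [m2 ?] /= <- E; exact: eq_exist.
Qed.

Lemma hom_shift_le (F G : toric_cell X) (m : toric_hom F G) :
  cell_le (cell_rep F) (cell_rep G + shift (hom_shift m)).
Proof.
apply/face_closureP; have := hom_shiftE m.
have [P [Q [_ _ _ PQ ->]]] := svalP m => -[u _ [<- <-]].
move=> _ [x /PQ Qx <-]; apply: closure_translate; by exists x.
Qed.

Lemma hom_shift_surj (F G : toric_cell X) v :
  cell_le (cell_rep F) (cell_rep G + shift v) ->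
  exists m : toric_hom F G, hom_shift m = v.
Proof.
move=> FG; pose P := face (cell_rep F); pose Q := face (cell_rep G + shift v).
have mP : is_toric_hom F G (pair_orbit P Q).
  exists P, Q; split=> //; first by split; exact: faces_face.
  - by apply/cell_face; exists 0; rewrite map_mx0 addr0.
  - by apply/cell_face; exists v.
  - exact/face_closureP.
exists (exist _ _ mP); apply: hom_shift_uniq => /=.
by exists 0; rewrite ?translate0.
Qed.

Lemma hom_shift_id F : hom_shift (toric_id F) = 0.
Proof.
apply: hom_shift_uniq; rewrite map_mx0 addr0 /=; split=> //.
by apply/cell_face; exists 0; rewrite map_mx0 addr0.
Qed.

Lemma hom_shift_comp (F G H : toric_cell X) (f : toric_hom F G)
    (g : toric_hom G H) :
  hom_shift (toric_comp f g) = hom_shift f + hom_shift g.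
Proof.
apply: hom_shift_uniq; exists (face (cell_rep G + shift (hom_shift f))).
  exact: hom_shiftE.
rewrite (hom_pair_orbit (hom_shiftE g)); exists (hom_shift f) => //.
by rewrite !translate_face -addrA -map_mxD [hom_shift g + _]addrC.
Qed.

End Bridge.

(** * The doubled arrangement and the category K *)

Section Doubling.
Variables (R : realType) (d n : nat) (X : arrangement_data R d n).
Local Notation V := 'rV[R]_d.
Local Notation shift v := (map_mx intr v : 'rV[R]_ _).

Definition column2 (j : 'I_n + 'I_n) : 'rV[int]_(d + d) :=
  match j with
  | inl j => row_mx (column X j) 0
  | inr j => row_mx 0 (column X j)
  end.

Definition offset2 (j : 'I_n + 'I_n) : R :=
  match j with inl j => offset X j | inr j => offset X j end.

Lemma dot_row_mx (p q x y : V) : dot (row_mx p q) (row_mx x y) =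
  dot p x + dot q y.
Proof.
rewrite /dot big_split_ord /=; congr (_ + _); apply: eq_bigr => k _.
  by rewrite !row_mxEl.
by rewrite !row_mxEr.
Qed.

Lemma height2l j (x y : V) :
  height column2 offset2 (inl j) (row_mx x y) =
    height (column X) (offset X) j x.
Proof. by rewrite /height /gen /= map_row_mx dot_row_mx map_mx0 dot0l addr0.
Qed.

Lemma height2r j (x y : V) :
  height column2 offset2 (inr j) (row_mx x y) =
    height (column X) (offset X) j y.
Proof. by rewrite /height /gen /= map_row_mx dot_row_mx map_mx0 dot0l add0r.
Qed.

Lemma cell_le2 (x y x' y' : V) :
  cell_le column2 offset2 (row_mx x y) (row_mx x' y') <->
  cell_le (column X) (offset X) x x' /\ cell_le (column X) (offset X) y y'.
Proof.
split=> [H|[Hx Hy] [j|j]].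
- by split=> j; [have := H (inl j)|have := H (inr j)];
    rewrite /low /high ?height2l ?height2r.
- by rewrite /low /high !height2l; exact: Hx.
- by rewrite /low /high !height2r; exact: Hy.
Qed.

Lemma row_mx_shift (x y : V) v w :
  row_mx x y + shift (row_mx v w) = row_mx (x + shift v) (y + shift w).
Proof. by rewrite map_row_mx add_row_mx. Qed.

(** The objects and morphisms of K, spelled out; [K_category] unfolds to them.
*)
Definition index : Type :=
  {FG : toric_cell X * toric_cell X | Defs.support FG.1 `&` Defs.support FG.2 =
    set0}.

Definition index_hom (i k : index) : Type :=
  (toric_hom (sval k).1 (sval i).1 * toric_hom (sval k).2 (sval i).2)%type.

Definition pair_rep (i : index) : 'rV[R]_(d + d) :=
  row_mx (cell_rep (sval i).1) (cell_rep (sval i).2).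

Local Notation pair_le := (cell_le column2 offset2).

Lemma pair_rep_up (i : index) z' : pair_le (pair_rep i) z' ->
  exists k v, pair_le z' (pair_rep k + shift v) /\
    pair_le (pair_rep k + shift v) z'.
Proof.
rewrite -[z']hsubmxK; move: (lsubmx _) (rsubmx _) => x y /cell_le2[Fx Gy].
have [v [xv vx]] := cell_of_rep X x; have [w [yw wy]] := cell_of_rep X y.
have disj : Defs.support (cell_of X x) `&` Defs.support (cell_of X y) = set0.
  rewrite -subset0 -(svalP i); apply: setISS.
    exact: supportS (cell_le_trans Fx xv).
  exact: supportS (cell_le_trans Gy yw).
exists (exist _ (cell_of X x, cell_of X y) disj), (row_mx v w).
by rewrite row_mx_shift; split; apply/cell_le2.
Qed.

Lemma pair_rep_sep (i k : index) v :
  pair_le (pair_rep i) (pair_rep k + shift v) ->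
  pair_le (pair_rep k + shift v) (pair_rep i) -> i = k /\ v = 0.
Proof.
rewrite -[v]hsubmxK; move: (lsubmx _) (rsubmx _) => u w.
rewrite row_mx_shift => /cell_le2[l1 l2] /cell_le2[h1 h2].
have [e1 ->] := cell_rep_sep l1 h1; have [e2 ->] := cell_rep_sep l2 h2.
rewrite row_mx0; split=> //.
case: i k e1 e2 {l1 l2 h1 h2} => [[F G] iP] [[F' G'] kP] /= e1 e2.
by subst; apply: eq_exist.
Qed.

Definition elliptic_complex : polyhedral_complex R :=
  tile_complex pair_rep_up pair_rep_sep.

Definition pair_shift (i k : index) (f : index_hom i k) : 'rV[int]_(d + d) :=
  row_mx (hom_shift f.1) (hom_shift f.2).

Lemma pair_shift_le (i k : index) (f : index_hom i k) :
  pair_le (pair_rep k) (pair_rep i + shift (pair_shift f)).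
Proof. by rewrite row_mx_shift; apply/cell_le2; split; exact: hom_shift_le. Qed.

Definition face_functor (i k : index) (f : index_hom i k) :
    @face_hom R elliptic_complex i k :=
  exist _ _ (face_translation pair_rep_up pair_rep_sep (pair_shift_le f)).

Lemma pair_shift_inj (i k : index) : injective (@pair_shift i k).
Proof.
move=> [f1 f2] [g1 g2] /eq_row_mx[E1 E2].
by congr pair; exact: hom_shift_inj.
Qed.

Lemma pair_shift_surj (i k : index) v :
  pair_le (pair_rep k) (pair_rep i + shift v) ->
  exists f : index_hom i k, pair_shift f = v.
Proof.
rewrite -[v]hsubmxK row_mx_shift => /cell_le2[H1 H2].
have [f1 f1E] := hom_shift_surj H1; have [f2 f2E] := hom_shift_surj H2.
by exists (f1, f2); rewrite /pair_shift f1E f2E.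
Qed.

Definition index_id (i : index) : index_hom i i :=
  (toric_id (sval i).1, toric_id (sval i).2).

Definition index_comp (i j k : index) (f : index_hom i j) (g : index_hom j k) :
  index_hom i k := (toric_comp g.1 f.1, toric_comp g.2 f.2).

Lemma pair_shift_id (i : index) : pair_shift (index_id i) = 0.
Proof. by rewrite /pair_shift !hom_shift_id row_mx0. Qed.

Lemma pair_shift_comp (i j k : index) (f : index_hom i j) (g : index_hom j k) :
  pair_shift (index_comp f g) = pair_shift f + pair_shift g.
Proof. by rewrite /pair_shift !hom_shift_comp add_row_mx; congr row_mx;
  exact: addrC. Qed.

Lemma face_functor_bij (i k : index) : bijective (@face_functor i k).
Proof.
apply: inj_surj_bijective => [f g E|[phi phiP]].
  apply: pair_shift_inj.
  exact: (translation_eq pair_rep_sep (pair_shift_le f) (pair_shift_le g)).1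
    (congr1 sval E).
have [v [H phiE]] := face_mapP phiP.
have [f fE] := pair_shift_surj H.
exists f; apply: eq_exist; rewrite phiE.
exact: (translation_eq pair_rep_sep (pair_shift_le f) H).2 fE.
Qed.

Lemma face_functor_id (i : index) :
  face_functor (index_id i) = @Defs.face_id R elliptic_complex i.
Proof.
apply: eq_exist; apply/funext => x; apply: val_inj.
change (\val x + period R column2 (pair_shift (index_id i)) = \val x).
by rewrite pair_shift_id period0 addr0.
Qed.

Lemma face_functor_comp (i j k : index) (f : index_hom i j)
    (g : index_hom j k) :
  face_functor (index_comp f g) =
  @face_comp R elliptic_complex i j k (face_functor f) (face_functor g).
Proof.
apply: eq_exist; apply/funext => x; apply: val_inj.
change (\val x + period R column2 (pair_shift (index_comp f g)) =
        \val x + period R column2 (pair_shift f) +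
        period R column2 (pair_shift g)).
by rewrite pair_shift_comp periodD addrA.
Qed.

End Doubling.

Theorem proposition3p10 (R : realType) (d n : nat)
    (X : arrangement_data R d n) :
  exists K : polyhedral_complex R,
    isomorphic_categories (K_category X) (face_category K).
Proof.
exists (elliptic_complex X), id, (@face_functor R d n X); split.
- by exists id.
- exact: face_functor_bij.
- exact: face_functor_id.
- exact: face_functor_comp.
Qed.
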